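(* Assume Problem (MF-LQ)$^0$ is finite and that there are symmetric $P_k,\Pi_k\in\mathbb R^{n\times n}$, $k=0,\dots,N-1$, with $V^0(l,\xi)=\mathbb E\langle P_l(\xi-\mathbb E\xi),\xi-\mathbb E\xi\rangle+\langle\Pi_l\mathbb E\xi,\mathbb E\xi\rangle$ for all $(l,\xi)$; set $P_N=G$, $\Pi_N=G+\bar G$. If for some $\alpha>0$ and all $k$, $$R_k+B_k'P_{k+1}B_k+D_k'P_{k+1}D_k\ge\alpha I,\qquad R_k+\bar R_k+(B_k+\bar B_k)'\Pi_{k+1}(B_k+\bar B_k)+(D_k+\bar D_k)'P_{k+1}(D_k+\bar D_k)\ge\alpha I,$$ then $(P,\Pi)$ is a solution of the GRE. Consequently the map $u\mapsto J^0(0,0;u)$ is uniformly convex.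
   Context: Fix integers $N\ge1$, $n,m\ge1$, $\mathbb N_0=\{0,\dots,N-1\}$. On a complete probability space, for initial time $l\in\mathbb N_0$, let $\omega_l,\dots,\omega_{N-1}$ be real random variables and $\xi$ a square-integrable $\mathbb R^n$-valued initial state independent of them; $\mathfrak F_k=\sigma\{\xi,\omega_l,\dots,\omega_k\}$, $\mathbb E[\omega_{k+1}|\mathfrak F_k]=0$, $\mathbb E[\omega_{k+1}^2|\mathfrak F_k]=1$. $\mathscr U_{ad}$: sequences $u=(u_l,\dots,u_{N-1})$, $u_k$ $\mathfrak F_k$-measurable in $\mathbb R^m$, $\mathbb E\sum|u_k|^2<\infty$. Problem (MF-LQ)$^0$: state $x_{k+1}=A_kx_k+\bar A_k\mathbb Ex_k+B_ku_k+\bar B_k\mathbb Eu_k+(C_kx_k+\bar C_k\mathbb Ex_k+D_ku_k+\bar D_k\mathbb Eu_k)\omega_k$, $x_l=\xi$; cost $J^0(l,\xi;u)=\mathbb E\{\langle Gx_N,x_N\rangle+\langle\bar G\mathbb Ex_N,\mathbb Ex_N\rangle+\sum_{k=l}^{N-1}[\langle Q_kx_k,x_k\rangle+2\langle S_ku_k,x_k\rangle+\langle R_ku_k,u_k\rangle+\langle\bar Q_k\mathbb Ex_k,\mathbb Ex_k\rangle+2\langle\bar S_k\mathbb Eu_k,\mathbb Ex_k\rangle+\langle\bar R_k\mathbb Eu_k,\mathbb Eu_k\rangle]\}$, deterministic $A_k,\bar A_k,C_k,\bar C_k,Q_k,\bar Q_k,G,\bar G\in\mathbb R^{n\times n}$,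 $B_k,\bar B_k,D_k,\bar D_k,S_k,\bar S_k\in\mathbb R^{n\times m}$, $R_k,\bar R_k\in\mathbb R^{m\times m}$, $Q,\bar Q,R,\bar R,G,\bar G$ symmetric; $V^0(l,\xi)=\inf_uJ^0(l,\xi;u)$; finite means $V^0(l,\xi)>-\infty$ for all $(l,\xi)$. Uniformly convex means: there is $\alpha'>0$ with $J^0(0,0;u)\ge\alpha'\mathbb E\sum_{k=0}^{N-1}|u_k|^2$ for all $u$. GRE: $\Upsilon_k=R_k+B_k'P_{k+1}B_k+D_k'P_{k+1}D_k$, $\bar\Upsilon_k=R_k+\bar R_k+(B_k+\bar B_k)'\Pi_{k+1}(B_k+\bar B_k)+(D_k+\bar D_k)'P_{k+1}(D_k+\bar D_k)$, $H_k=B_k'P_{k+1}A_k+D_k'P_{k+1}C_k+S_k'$, $\bar H_k=(B_k+\bar B_k)'\Pi_{k+1}(A_k+\bar A_k)+(D_k+\bar D_k)'P_{k+1}(C_k+\bar C_k)+S_k'+\bar S_k'$; $P_k=Q_k+A_k'P_{k+1}A_k+C_k'P_{k+1}C_k-H_k'\Upsilon_k^\dagger H_k$, $\Pi_k=Q_k+\bar Q_k+(A_k+\bar A_k)'\Pi_{k+1}(A_k+\bar A_k)+(C_k+\bar C_k)'P_{k+1}(C_k+\bar C_k)-\bar H_k'\bar\Upsilon_k^\dagger\bar H_k$, $P_N=G$, $\Pi_N=G+\bar G$ ($\dagger$ = Moore–Penrose pseudoinverse).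
   Formalization: Controls u_k are measurable w.r.t. σ{ξ,ω_l,…,ω_{k-1}} and the noise conditions are E[ω_k|F_{k-1}]=0, E[ω_k²|F_{k-1}]=1 (letting u_k see ω_k makes the claim false); the space is assumed to carry a centered R^n vector with identity covariance independent of all ω_k, else P_0 is undetermined. *)

(* Defs.v *)
From HB Require Import structures.
From mathcomp Require Import all_boot all_order all_algebra.
From mathcomp Require Import all_classical all_reals all_analysis.
Set Implicit Arguments. Unset Strict Implicit. Unset Printing Implicit Defensive.
Import Order.TTheory GRing.Theory Num.Theory.
Local Open Scope classical_set_scope.
Local Open Scope ring_scope.

Record mflq (R : realType) (n m : nat) := MFLQ {
  cA : nat -> 'M[R]_n ;  cAb : nat -> 'M[R]_n ;
  cB : nat -> 'M[R]_(n, m) ; cBb : nat -> 'M[R]_(n, m) ;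
  cC : nat -> 'M[R]_n ;  cCb : nat -> 'M[R]_n ;
  cD : nat -> 'M[R]_(n, m) ; cDb : nat -> 'M[R]_(n, m) ;
  cQ : nat -> 'M[R]_n ;  cQb : nat -> 'M[R]_n ;
  cS : nat -> 'M[R]_(n, m) ; cSb : nat -> 'M[R]_(n, m) ;
  cR : nat -> 'M[R]_m ;  cRb : nat -> 'M[R]_m ;
  cG : 'M[R]_n ; cGb : 'M[R]_n }.

Section Algebra.
Context {R : realType}.

Definition qf {k} (M : 'M[R]_k) (v : 'cV[R]_k) : R := (v^T *m M *m v) 0 0.
Definition bf {n m} (S : 'M[R]_(n, m)) (u : 'cV[R]_m) (x : 'cV[R]_n) : R :=
  (x^T *m (S *m u)) 0 0.
Definition sqnorm {k} (v : 'cV[R]_k) : R := (v^T *m v) 0 0.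
Definition mx_ge_scalar {k} (M : 'M[R]_k) (alpha : R) : Prop :=
  forall v : 'cV[R]_k, 0 <= qf (M - alpha%:M) v.
Definition is_mp_pinv {k} (M X : 'M[R]_k) : Prop :=
  [/\ M *m X *m M = M, X *m M *m X = X, (M *m X)^T = M *m X & (X *m M)^T = X *m M].
Definition mpinv {k} (M : 'M[R]_k) : 'M[R]_k := xget 0 [set X | is_mp_pinv M X].

Section GRE.
Context {n m : nat} (sys : mflq R n m) (N : nat) (P Pi : nat -> 'M[R]_n).

Definition Ups k : 'M[R]_m :=
  cR sys k + (cB sys k)^T *m P k.+1 *m cB sys k + (cD sys k)^T *m P k.+1 *m cD sys k.
Definition Upsb k : 'M[R]_m :=
  cR sys k + cRb sys k
  + (cB sys k + cBb sys k)^T *m Pi k.+1 *m (cB sys k + cBb sys k)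
  + (cD sys k + cDb sys k)^T *m P k.+1 *m (cD sys k + cDb sys k).
Definition Hm k : 'M[R]_(m, n) :=
  (cB sys k)^T *m P k.+1 *m cA sys k + (cD sys k)^T *m P k.+1 *m cC sys k
  + (cS sys k)^T.
Definition Hmb k : 'M[R]_(m, n) :=
  (cB sys k + cBb sys k)^T *m Pi k.+1 *m (cA sys k + cAb sys k)
  + (cD sys k + cDb sys k)^T *m P k.+1 *m (cC sys k + cCb sys k)
  + (cS sys k)^T + (cSb sys k)^T.

Definition GRE_solution : Prop :=
  [/\ P N = cG sys, Pi N = cG sys + cGb sys &
   forall k, (k < N)%N ->
     P k = cQ sys k + (cA sys k)^T *m P k.+1 *m cA sys k
           + (cC sys k)^T *m P k.+1 *m cC sys k
           - (Hm k)^T *m mpinv (Ups k) *m Hm k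
     /\ Pi k = cQ sys k + cQb sys k
           + (cA sys k + cAb sys k)^T *m Pi k.+1 *m (cA sys k + cAb sys k)
           + (cC sys k + cCb sys k)^T *m P k.+1 *m (cC sys k + cCb sys k)
           - (Hmb k)^T *m mpinv (Upsb k) *m Hmb k].
End GRE.
End Algebra.

Section Prob.
Context {R : realType} {d : measure_display} {T : measurableType d}.
Variable mu : probability T R.

(* expectation of a real random variable (meaningful when integrable) *)
Definition Ex (f : T -> R) : R := fine (\int[mu]_w (f w)%:E)%E.
Definition Evec {k} (X : T -> 'cV[R]_k) : 'cV[R]_k := \col_i Ex (fun w => X w i 0).

Definition sq_int (f : T -> R) : Prop :=
  measurable_fun setT f /\ mu.-integrable setT (fun w => (f w ^+ 2)%:E).
Definition sq_int_vec {k} (X : T -> 'cV[R]_k) : Prop :=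
  forall i, sq_int (fun w => X w i 0).

Definition preimages (F : set (T -> R)) : set (set T) :=
  [set A | exists f, F f /\ exists B : set R, measurable B /\ A = f @^-1` B].
Definition sigma_gen (F : set (T -> R)) : set (set T) := <<s preimages F >>.
Definition meas_wrt (G : set (set T)) (f : T -> R) : Prop :=
  forall B : set R, measurable B -> G (f @^-1` B).
Definition indep (F1 F2 : set (T -> R)) : Prop :=
  forall A B, sigma_gen F1 A -> sigma_gen F2 B -> mu (A `&` B) = (mu A * mu B)%E.
Definition is_cond_exp (G : set (set T)) (X Y : T -> R) : Prop :=
  [/\ mu.-integrable setT (EFin \o X), mu.-integrable setT (EFin \o Y),
      meas_wrt G Y &
      forall A, G A -> (\int[mu]_(w in A) (X w)%:E)%E = (\int[mu]_(w in A) (Y w)%:E)%E].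

Definition coords {k} (X : T -> 'cV[R]_k) : set (T -> R) :=
  [set f | exists i, f = fun w => X w i 0].
Definition noise_fam (om : nat -> T -> R) (a b : nat) : set (T -> R) :=
  [set f | exists j, (a <= j < b)%N /\ f = om j].
(* information available when choosing u_k, started at (l, xi):
   sigma{xi, omega_l, ..., omega_(k-1)}  (= F_(k-1) in the paper, F_(l-1) = sigma{xi}) *)
Definition info {n} (om : nat -> T -> R) (l : nat) (xi : T -> 'cV[R]_n) (k : nat)
  : set (set T) := sigma_gen (coords xi `|` noise_fam om l k).

Section Problem.
Context {n m : nat} (sys : mflq R n m) (N : nat) (om : nat -> T -> R).

Definition init_adm (l : nat) (xi : T -> 'cV[R]_n) : Prop :=
  sq_int_vec xi /\ indep (coords xi) (noise_fam om l N).

Definition noise_cond (l : nat) (xi : T -> 'cV[R]_n) : Prop :=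
  forall k, (l <= k < N)%N ->
    is_cond_exp (info om l xi k) (om k) (fun _ => 0)
    /\ is_cond_exp (info om l xi k) (fun w => om k w ^+ 2) (fun _ => 1).

Definition ctrl_adm (l : nat) (xi : T -> 'cV[R]_n) (u : nat -> T -> 'cV[R]_m) : Prop :=
  forall k, (l <= k < N)%N -> forall i,
    meas_wrt (info om l xi k) (fun w => u k w i 0) /\ sq_int (fun w => u k w i 0).

(* trajectory: traj l xi u j = x_(l+j) *)
Fixpoint traj (l : nat) (xi : T -> 'cV[R]_n) (u : nat -> T -> 'cV[R]_m) (j : nat)
  : T -> 'cV[R]_n :=
  match j with
  | 0 => xi
  | j'.+1 =>
    let k := (l + j')%N in
    let x := traj l xi u j' in
    fun w =>
      cA sys k *m x w + cAb sys k *m Evec x + cB sys k *m u k w + cBb sys k *m Evec (u k)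
      + om k w *: (cC sys k *m x w + cCb sys k *m Evec x + cD sys k *m u k w
                   + cDb sys k *m Evec (u k))
  end.
Definition state l xi u (k : nat) : T -> 'cV[R]_n := traj l xi u (k - l).

Definition J (l : nat) (xi : T -> 'cV[R]_n) (u : nat -> T -> 'cV[R]_m) : R :=
  let x := state l xi u in
  Ex (fun w => qf (cG sys) (x N w)) + qf (cGb sys) (Evec (x N))
  + \sum_(l <= k < N)
      (Ex (fun w => qf (cQ sys k) (x k w) + 2 * bf (cS sys k) (u k w) (x k w)
                    + qf (cR sys k) (u k w))
       + qf (cQb sys k) (Evec (x k))
       + 2 * bf (cSb sys k) (Evec (u k)) (Evec (x k))
       + qf (cRb sys k) (Evec (u k))).

Definition V (l : nat) (xi : T -> 'cV[R]_n) : \bar R :=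
  ereal_inf [set (J l xi u)%:E | u in ctrl_adm l xi].
End Problem.
End Prob.

(* Main.v *)
(** Splitting state and control into mean and centered part, the noise terms decouple and
    completing the square twice (with weights [Ups], [Upsb]) gives
      cost_k(x, u) + W_{k+1}(x_{k+1}) = W'_k(x_k) + residual_k(x, u),
    where [W_k] is the quadratic form with weights [(P_k, Pi_k)] and [W'_k] the one whose weights
    are the right-hand sides of the Riccati recursion.  If the recursion already holds beyond [l],
    then [J = W'_l(xi) + sum of residuals]; the residuals are nonnegative and vanish under the
    linear feedback, so [V(l, .) = W'_l].  Testing the assumed representation of [V] on
    [xi = eta_0 v + c] identifies [(P_l, Pi_l)] with the Riccati right-hand sides, by descending
    induction.  At [xi = 0] the cost is the sum of the residuals, which dominates [alpha] times
    the energy of the deviation of [u] from the feedback; this energy controls that of [u], because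
    the state is driven by the deviation through a linear recursion started at [0]. *)

Require Import Defs.
From HB Require Import structures.
From mathcomp Require Import all_boot all_order all_algebra.
From mathcomp Require Import all_classical all_reals all_analysis.
From mathcomp Require Import measurable_realfun ring lra.
Set Implicit Arguments. Unset Strict Implicit. Unset Printing Implicit Defensive.
Import Order.TTheory GRing.Theory Num.Theory.
Local Open Scope classical_set_scope.
Local Open Scope ring_scope.

Definition bl {R : realType} {k p} (M : 'M[R]_(k, p)) (x : 'cV[R]_k) (y : 'cV[R]_p) : R :=
  (x^T *m M *m y) 0 0.

Section BilinearForms.
Context {R : realType}.

Lemma mx11_tr (M : 'M[R]_1) : M^T = M.
Proof. by apply/matrixP => i j; rewrite mxE !ord1. Qed.

Lemma qfE k (M : 'M[R]_k) x : qf M x = bl M x x.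
Proof. by []. Qed.

Lemma bfE k p (S : 'M[R]_(k, p)) u x : bf S u x = bl S x u.
Proof. by rewrite /bf /bl mulmxA. Qed.

Lemma sqnormE k (x : 'cV[R]_k) : sqnorm x = qf 1%:M x.
Proof. by rewrite /qf mulmx1. Qed.

Lemma blT k p (M : 'M[R]_(k, p)) x y : bl M^T y x = bl M x y.
Proof.
rewrite /bl -[in RHS](trmxK (x^T *m M *m y)) mx11_tr.
by rewrite !trmx_mul trmxK mulmxA.
Qed.

Lemma bl_sym k (M : 'M[R]_k) x y : M^T = M -> bl M y x = bl M x y.
Proof. by move=> Ms; rewrite -[in LHS]Ms blT. Qed.

Lemma blDl k p (M : 'M[R]_(k, p)) x x' y : bl M (x + x') y = bl M x y + bl M x' y.
Proof. by rewrite /bl linearD /= !mulmxDl mxE. Qed.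

Lemma blDr k p (M : 'M[R]_(k, p)) x y y' : bl M x (y + y') = bl M x y + bl M x y'.
Proof. by rewrite /bl mulmxDr mxE. Qed.

Lemma blDm k p (M M' : 'M[R]_(k, p)) x y : bl (M + M') x y = bl M x y + bl M' x y.
Proof. by rewrite /bl mulmxDr mulmxDl mxE. Qed.

Lemma blNm k p (M : 'M[R]_(k, p)) x y : bl (- M) x y = - bl M x y.
Proof. by rewrite /bl mulmxN mulNmx mxE. Qed.

Lemma blZl k p (M : 'M[R]_(k, p)) a x y : bl M (a *: x) y = a * bl M x y.
Proof. by rewrite /bl linearZ /= -!scalemxAl mxE. Qed.

Lemma blZr k p (M : 'M[R]_(k, p)) a x y : bl M x (a *: y) = a * bl M x y.
Proof. by rewrite /bl -scalemxAr mxE. Qed.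

Lemma bl0l k p (M : 'M[R]_(k, p)) y : bl M 0 y = 0.
Proof. by rewrite /bl trmx0 !mul0mx mxE. Qed.

Lemma bl_mull k p q (M : 'M[R]_(k, p)) (A : 'M[R]_(k, q)) x y :
  bl M (A *m x) y = bl (A^T *m M) x y.
Proof. by rewrite /bl trmx_mul !mulmxA. Qed.

Lemma bl_mulr k p q (M : 'M[R]_(k, p)) (A : 'M[R]_(p, q)) x y :
  bl M x (A *m y) = bl (M *m A) x y.
Proof. by rewrite /bl !mulmxA. Qed.

Lemma bl_sum k p (M : 'M[R]_(k, p)) x y :
  bl M x y = \sum_i \sum_j M i j * (x i 0 * y j 0).
Proof.
rewrite /bl mxE exchange_big; apply: eq_bigr => j _ /=.
rewrite mxE mulr_suml; apply: eq_bigr => i _; rewrite mxE; ring.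
Qed.

Lemma sqnorm_sum k (x : 'cV[R]_k) : sqnorm x = \sum_i x i 0 ^+ 2.
Proof. by rewrite /sqnorm mxE; apply: eq_bigr => i _; rewrite mxE expr2. Qed.

Lemma sqnorm_ge0 k (x : 'cV[R]_k) : 0 <= sqnorm x.
Proof. by rewrite sqnorm_sum sumr_ge0 // => i _; rewrite sqr_ge0. Qed.

Lemma sqnorm_eq0 k (x : 'cV[R]_k) : sqnorm x = 0 -> x = 0.
Proof.
rewrite sqnorm_sum => /eqP; rewrite psumr_eq0 => [/allP x0|i _]; last exact: sqr_ge0.
apply/matrixP => i j; rewrite ord1 mxE.
by have := x0 i (mem_index_enum i); rewrite sqrf_eq0 => /eqP.
Qed.

Lemma sqrD_le (a b : R) : (a + b) ^+ 2 <= 2 * a ^+ 2 + 2 * b ^+ 2.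
Proof. by have := sqr_ge0 (a - b); rewrite sqrrB sqrrD; lra. Qed.

Lemma sqnormD_le k (x y : 'cV[R]_k) : sqnorm (x + y) <= 2 * sqnorm x + 2 * sqnorm y.
Proof.
rewrite !sqnorm_sum !mulr_sumr -big_split /=; apply: ler_sum => i _.
by rewrite mxE sqrD_le.
Qed.

Lemma sqr_sum_le (I : finType) (F : I -> R) :
  (\sum_i F i) ^+ 2 <= #|I|%:R * \sum_i F i ^+ 2.
Proof.
have ineq i j : F i * F j <= (F i ^+ 2 + F j ^+ 2) / 2.
  by have := sqr_ge0 (F i - F j); rewrite sqrrB; lra.
apply: (@le_trans _ _ (\sum_i \sum_j (F i ^+ 2 + F j ^+ 2) / 2)).
  rewrite expr2 mulr_suml; apply: ler_sum => i _.
  by rewrite mulr_sumr; apply: ler_sum => j _.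
rewrite (eq_bigr (fun i => (#|I|%:R * F i ^+ 2 + \sum_j F j ^+ 2) / 2)); last first.
  by move=> i _; rewrite -mulr_suml big_split /= sumr_const -[_ *+ #|_|]mulr_natl.
rewrite -mulr_suml big_split /= -mulr_sumr sumr_const -[_ *+ #|_|]mulr_natl.
lra.
Qed.

Lemma sqnorm_mul_le k p (M : 'M[R]_(k, p)) :
  exists2 c, 0 <= c & forall x, sqnorm (M *m x) <= c * sqnorm x.
Proof.
exists (\sum_i \sum_j #|'I_p|%:R * M i j ^+ 2).
  by do 2![apply: sumr_ge0 => ? _]; rewrite mulr_ge0 // sqr_ge0.
move=> x; rewrite sqnorm_sum mulr_suml; apply: ler_sum => i _; rewrite mxE.
apply: (le_trans (@sqr_sum_le _ (fun j => M i j * x j 0))); rewrite -mulr_sumr -mulrA ler_wpM2l //.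
rewrite mulr_suml; apply: ler_sum => j _; rewrite exprMn ler_wpM2l ?sqr_ge0 //.
by rewrite sqnorm_sum (bigD1 j) //= lerDl sumr_ge0 // => l _; rewrite sqr_ge0.
Qed.

Lemma qf_inj k (M M' : 'M[R]_k) : M^T = M -> M'^T = M' ->
  (forall x, qf M x = qf M' x) -> M = M'.
Proof.
move=> Ms Ms' e; apply/matrixP => i j.
have blE (L : 'M[R]_k) : bl L (delta_mx i 0) (delta_mx j 0) = L i j.
  by rewrite /bl trmx_delta -rowE -colE !mxE.
have pol (L : 'M[R]_k) x y : L^T = L -> 2 * bl L x y = qf L (x + y) - qf L x - qf L y.
  by move=> Ls; rewrite !qfE blDl !blDr (@bl_sym _ L x y) //; ring.
apply: (@mulfI _ 2); rewrite ?pnatr_eq0 // -!blE.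
by rewrite !pol // !e.
Qed.

Lemma mx_ge_scalarP k (M : 'M[R]_k) a :
  mx_ge_scalar M a <-> forall x, a * sqnorm x <= qf M x.
Proof.
split=> h x; have := h x; rewrite !qfE blDm blNm sqnormE qfE;
  have -> : bl a%:M x x = a * bl 1%:M x x
    by rewrite /bl mul_mx_scalar mulmx1 -scalemxAl [LHS]mxE.
- by rewrite subr_ge0.
- by rewrite subr_ge0.
Qed.

Lemma mx_ge_scalar_unit k (M : 'M[R]_k) a : 0 < a -> mx_ge_scalar M a -> M \in unitmx.
Proof.
move=> a0 /mx_ge_scalarP h; rewrite -row_free_unit -kermx_eq0.
apply/eqP/row_matrixP => i; rewrite row0.
set u := row i _; have uM : u *m M = 0 by rewrite -row_mul mulmx_ker row0.
have := h u^T; rewrite /qf trmxK uM mul0mx mxE => hu.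
apply: trmx_inj; rewrite trmx0; apply: sqnorm_eq0; apply/eqP.
by rewrite eq_le sqnorm_ge0 andbT -(pmulr_rle0 _ a0).
Qed.

Lemma mpinv_unit k (M : 'M[R]_k) : M \in unitmx -> mpinv M = invmx M.
Proof.
move=> Mu; rewrite /mpinv; case: xgetP => [X _ [MXM _ _ _]|/(_ (invmx M))[]].
  rewrite -[X]mul1mx -(mulVmx Mu) -mulmxA -[X]mulmx1 -(mulmxV Mu).
  by rewrite !mulmxA -(mulmxA _ M X) -(mulmxA _ (M *m X)) MXM mulVmx // mul1mx.
by split; rewrite ?mulmxV ?mulVmx ?mul1mx ?trmx1.
Qed.

Lemma complete_square n m (Q A C : 'M[R]_n) (S B D : 'M[R]_(n, m)) (Rr : 'M[R]_m)
    (P1 P2 : 'M[R]_n) x u :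
  Rr^T = Rr -> P1^T = P1 -> P2^T = P2 ->
  let U := Rr + B^T *m P1 *m B + D^T *m P2 *m D in
  let H := B^T *m P1 *m A + D^T *m P2 *m C + S^T in
  U \in unitmx ->
  qf Q x + 2 * bf S u x + qf Rr u + qf P1 (A *m x + B *m u) + qf P2 (C *m x + D *m u)
  = qf (Q + A^T *m P1 *m A + C^T *m P2 *m C - H^T *m mpinv U *m H) x
    + qf U (u + invmx U *m H *m x).
Proof.
move=> Rs P1s P2s U H Uu; rewrite mpinv_unit //.
have Us : U^T = U.
  by rewrite /U !raddfD /= !trmx_mul !trmxK Rs P1s P2s !mulmxA.
have UV : U *m (invmx U *m H) = H by rewrite mulKVmx.
have Vt : (invmx U *m H)^T *m U = H^T by rewrite -{2}Us -trmx_mul UV.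
rewrite -(mulmxA _ (invmx U) H); move: (invmx U *m H) UV Vt => K UV Vt.
have UK y : bl U y (K *m x) = bl H y x by rewrite bl_mulr UV.
have KU : bl U (K *m x) u = bl H u x by rewrite (@bl_sym _ U) // UK.
have KK : bl U (K *m x) (K *m x) = bl (H^T *m K) x x by rewrite bl_mull Vt bl_mulr.
have -> : qf U (u + K *m x) = bl U u u + 2 * bl H u x + bl (H^T *m K) x x.
  by rewrite qfE blDl !(@blDr _ _ U) UK KU KK; ring.
rewrite !qfE bfE /U /H !(blDl, blDr, blDm, blNm) !bl_mull !bl_mulr ?mulmxA blT.
rewrite -(blT (B^T *m P1 *m A)) -(blT (D^T *m P2 *m C)) !trmx_mul !trmxK P1s P2s !mulmxA.
ring.
Qed.
End BilinearForms.

Section Weights.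
Import HBNNSimple numFieldNormedType.Exports.
Context {R : realType} {d : measure_display} {T : measurableType d}.
Variable mu : probability T R.

Let mnorm : measurable_fun [set: R] (fun x : R => (`|x|)%:E).
Proof. by apply/measurable_EFinP; exact: normr_measurable. Qed.

Let h := nnsfun_approx (@measurableT _ R) mnorm.

Lemma ge0_integral_weight_cvg (Z f : T -> R) :
  measurable_fun setT Z -> (forall w, 0 <= Z w) ->
  measurable_fun setT f -> (forall w, 0 <= f w) ->
  (\sum_(y \in range (h j)) (y%:E * \int[mu]_(w in Z @^-1` (h j @^-1` [set y])) (f w)%:E)
    @[j --> \oo] --> \int[mu]_w (Z w * f w)%:E)%E.
Proof.
move=> mZ Z0 mf f0.
have mhZ j y : measurable (Z @^-1` (h j @^-1` [set y])).
  by rewrite -[X in measurable X]setTI; apply: mZ.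
have mh j : measurable_fun setT (fun w => h j (Z w)) by apply: measurableT_comp.
have -> : (fun j => \sum_(y \in range (h j)) (y%:E * \int[mu]_(w in Z @^-1` (h j @^-1` [set y])) (f w)%:E))%E
   = (fun j => \int[mu]_w (h j (Z w) * f w)%:E)%E.
  apply/funext => j.
  transitivity (\int[mu]_w (\sum_(y \in range (h j)) (y * (\1_(Z @^-1` (h j @^-1` [set y])) w * f w))%:E))%E.
    rewrite ge0_integral_fsum //=.
    - apply: eq_fsbigr => y /set_mem [x _ <-].
      rewrite integral_mkcond epatch_indic.
      rewrite -ge0_integralZl //.
      + by apply: eq_integral => w _; rewrite /= -!EFinM [_ * f w]mulrC.
      + by apply/measurable_EFinP; apply: measurable_funM => //; exact: measurable_indic.
      + by move=> w _ /=; rewrite lee_fin mulr_ge0.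
      + by rewrite lee_fin.
    - move=> y; apply/measurable_EFinP; apply: measurable_funM => //.
      by apply: measurable_funM => //; exact: measurable_indic.
    - move=> y w _; rewrite lee_fin mulrA mulr_ge0 // indicE.
      by case: (boolP (w \in Z @^-1` (h j @^-1` [set y]))) => // [/set_mem /= <-|_]; rewrite ?mulr1 ?mulr0.
  apply: eq_integral => w _.
  rewrite fsbig_finite //= sumEFin; congr EFin.
  rewrite [in RHS](fimfunE (h j)) fsbig_finite //= mulr_suml.
  by apply: eq_bigr => y _; rewrite mulrA.
have Ze w : (h j (Z w) * f w)%:E @[j --> \oo] --> (Z w * f w)%:E.
  apply/fine_cvgP; split; first by apply: nearW => j.
  have /fine_cvgP[_ hZ] := @cvg_nnsfun_approx _ _ _ _ (@measurableT _ R) _ mnorm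
    (fun x _ => normr_ge0 x) (Z w) I.
  have -> : Z w * f w = `|Z w| * f w by rewrite ger0_norm.
  by apply: cvgMr_tmp; exact: hZ.
have -> : (\int[mu]_w (Z w * f w)%:E = \int[mu]_w (limn (fun j => (h j (Z w) * f w)%:E)))%E.
  by apply: eq_integral => w _; apply/esym/cvg_lim.
apply: (@cvg_monotone_convergence _ _ _ mu setT measurableT
  (fun j w => (h j (Z w) * f w)%:E)).
- by move=> j; apply/measurable_EFinP; exact: measurable_funM.
- by move=> j w _; rewrite lee_fin mulr_ge0.
- move=> w _ i j ij; rewrite lee_fin ler_wpM2r //.
  exact/lefP/nd_nnsfun_approx.
Unshelve. all: by end_near.
Qed.

Lemma ge0_integral_weight (G : set (set T)) (Z f g : T -> R) :
  meas_wrt G Z -> measurable_fun setT Z -> (forall w, 0 <= Z w) ->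
  measurable_fun setT f -> (forall w, 0 <= f w) ->
  measurable_fun setT g -> (forall w, 0 <= g w) ->
  (forall A, G A -> \int[mu]_(w in A) (f w)%:E = \int[mu]_(w in A) (g w)%:E)%E ->
  (\int[mu]_w (Z w * f w)%:E = \int[mu]_w (Z w * g w)%:E)%E.
Proof.
move=> GZ mZ Z0 mf f0 mg g0 fg.
have cf := ge0_integral_weight_cvg mZ Z0 mf f0.
have cg := ge0_integral_weight_cvg mZ Z0 mg g0.
apply: (cvg_unique (@ereal_hausdorff R) cf).
suff -> : (fun j => \sum_(y \in range (h j))
    (y%:E * \int[mu]_(w in Z @^-1` (h j @^-1` [set y])) (f w)%:E))%E =
  (fun j => \sum_(y \in range (h j))
    (y%:E * \int[mu]_(w in Z @^-1` (h j @^-1` [set y])) (g w)%:E))%E by exact: cg.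
apply/funext => j; apply: eq_fsbigr => y _; rewrite fg //; exact: GZ.
Qed.
End Weights.

Section Expectation.
Context {R : realType} {d : measure_display} {T : measurableType d}.
Variable mu : probability T R.
Implicit Types f g : T -> R.

Definition rintegrable f := mu.-integrable setT (EFin \o f).

Lemma rintegrable_fin f : rintegrable f -> (\int[mu]_w (f w)%:E \is a fin_num)%E.
Proof. by move=> fi; exact: (integrable_fin_num measurableT fi). Qed.

Lemma rintegrableD f g : rintegrable f -> rintegrable g -> rintegrable (fun w => f w + g w).
Proof. by move=> fi gi; exact: (integrableD measurableT fi gi). Qed.

Lemma rintegrableZ c f : rintegrable f -> rintegrable (fun w => c * f w).
Proof. by move=> fi; exact: (integrableZl measurableT c fi). Qed.

Lemma rintegrable_cst c : rintegrable (fun=> c).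
Proof. exact: finite_measure_integrable_cst. Qed.

Lemma rintegrable_sum (I : Type) (r : seq I) (F : I -> T -> R) :
  (forall i, rintegrable (F i)) -> rintegrable (fun w => \sum_(i <- r) F i w).
Proof.
move=> Fi; elim: r => [|i r IH].
  by rewrite (_ : (fun _ => _) = fun=> 0) ?funeqE => [|w]; rewrite ?big_nil //; exact: rintegrable_cst.
rewrite (_ : (fun _ => _) = fun w => F i w + \sum_(j <- r) F j w); last first.
  by apply/funext => w; rewrite big_cons.
exact: rintegrableD.
Qed.

Lemma Ex_cst c : Ex mu (fun=> c) = c.
Proof. by rewrite /Ex integral_cst //= probability_setT mule1. Qed.

Lemma ExD f g : rintegrable f -> rintegrable g ->
  Ex mu (fun w => f w + g w) = Ex mu f + Ex mu g.
Proof.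
move=> fi gi; rewrite /Ex -fineD ?rintegrable_fin //; congr fine.
exact: (integralD_EFin measurableT fi gi).
Qed.

Lemma ExZ c f : rintegrable f -> Ex mu (fun w => c * f w) = c * Ex mu f.
Proof.
move=> fi; rewrite /Ex -[c in RHS]/(fine c%:E) -fineM ?rintegrable_fin //; congr fine.
exact: (integralZl measurableT fi).
Qed.

Lemma Ex_sum (I : Type) (r : seq I) (F : I -> T -> R) :
  (forall i, rintegrable (F i)) ->
  Ex mu (fun w => \sum_(i <- r) F i w) = \sum_(i <- r) Ex mu (F i).
Proof.
move=> Fi; elim: r => [|i r IH].
  rewrite big_nil -[RHS](Ex_cst 0); congr Ex; apply/funext => w; exact: big_nil.
rewrite big_cons -IH -ExD //; last exact: rintegrable_sum.
by congr Ex; apply/funext => w; rewrite big_cons.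
Qed.

Lemma Ex_ge0 f : (forall w, 0 <= f w) -> 0 <= Ex mu f.
Proof. by move=> f0; apply/fine_ge0/integral_ge0 => w _; rewrite lee_fin. Qed.

Lemma Ex_le f g : rintegrable f -> rintegrable g -> (forall w, f w <= g w) ->
  Ex mu f <= Ex mu g.
Proof.
move=> fi gi fg; have Ni := rintegrableZ (-1) fi.
have: 0 <= Ex mu (fun w => g w + -1 * f w).
  by apply: Ex_ge0 => w; rewrite mulN1r subr_ge0.
by rewrite ExD // ExZ // mulN1r subr_ge0.
Qed.

Lemma sq_int_cst c : sq_int mu (fun=> c).
Proof. by split => //; exact: rintegrable_cst. Qed.

Lemma sq_intM_int f g : sq_int mu f -> sq_int mu g -> rintegrable (fun w => f w * g w).
Proof.
move=> [mf fi] [mg gi].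
have := rintegrableD fi gi; apply: le_integrable => //.
  by apply/measurable_EFinP; exact: measurable_funM.
move=> w _ /=; rewrite lee_fin (ger0_norm (addr_ge0 _ _)) ?sqr_ge0 // normrM.
rewrite -(real_normK (num_real (f w))) -(real_normK (num_real (g w))).
have := normr_ge0 (f w); have := normr_ge0 (g w).
move: `|f w| `|g w| => a b b0 a0; have := sqr_ge0 (a - b); rewrite sqrrB.
nra.
Qed.

Lemma sq_int_int f : sq_int mu f -> rintegrable f.
Proof.
move=> fi; rewrite (_ : f = fun w => f w * 1); last by apply/funext => w; rewrite mulr1.
exact: (sq_intM_int fi (sq_int_cst 1)).
Qed.

Lemma sq_intD f g : sq_int mu f -> sq_int mu g -> sq_int mu (fun w => f w + g w).
Proof.
move=> fi gi; split; first exact: measurable_funD fi.1 gi.1.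
rewrite (_ : (fun w => _) = EFin \o (fun w => f w ^+ 2 + (2 * (f w * g w) + g w ^+ 2))).
  exact/(rintegrableD fi.2)/rintegrableD/gi.2/rintegrableZ/sq_intM_int.
by apply/funext => w /=; congr EFin; ring.
Qed.

Lemma sq_intZ c f : sq_int mu f -> sq_int mu (fun w => c * f w).
Proof.
move=> [mf fi]; split; first exact: measurable_funM.
rewrite (_ : (fun w => _) = EFin \o (fun w => c ^+ 2 * (f w) ^+ 2)).
  exact: rintegrableZ fi.
by apply/funext => w /=; congr EFin; rewrite exprMn.
Qed.

End Expectation.

Section Noise.
Context {R : realType} {d : measure_display} {T : measurableType d}.
Variable mu : probability T R.
Variable F : set (T -> R).

Lemma meas_wrtP (f : T -> R) : meas_wrt (sigma_gen F) f <->
  measurable_fun (T := g_sigma_algebraType (preimages F)) setT (f : T -> R).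
Proof.
split=> [mf _ B mB|mf B mB]; first by rewrite setTI; exact: mf.
by have := mf measurableT B mB; rewrite setTI.
Qed.

Definition l2_wrt (f : T -> R) := meas_wrt (sigma_gen F) f /\ sq_int mu f.

Lemma l2_wrt_cst c : l2_wrt (fun=> c).
Proof. by split; [apply/meas_wrtP | exact: sq_int_cst]. Qed.

Lemma l2_wrtD f g : l2_wrt f -> l2_wrt g -> l2_wrt (fun w => f w + g w).
Proof.
move=> [/meas_wrtP mf fi] [/meas_wrtP mg gi]; split; last exact: sq_intD.
by apply/meas_wrtP; exact: measurable_funD.
Qed.

Lemma l2_wrtZ c f : l2_wrt f -> l2_wrt (fun w => c * f w).
Proof.
move=> [/meas_wrtP mf fi]; split; last exact: sq_intZ.
by apply/meas_wrtP; exact: measurable_funM.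
Qed.

Lemma l2_wrt_sum (I : Type) (r : seq I) (f : I -> T -> R) :
  (forall i, l2_wrt (f i)) -> l2_wrt (fun w => \sum_(i <- r) f i w).
Proof.
move=> Fi; elim: r => [|i r IH].
  by rewrite (_ : (fun _ => _) = fun=> 0) ?funeqE => [|w]; rewrite ?big_nil //; exact: l2_wrt_cst.
rewrite (_ : (fun _ => _) = fun w => f i w + \sum_(j <- r) f j w); last first.
  by apply/funext => w; rewrite big_cons.
exact: l2_wrtD.
Qed.

Definition white (v : T -> R) :=
  is_cond_exp mu (sigma_gen F) v (fun=> 0) /\
  is_cond_exp mu (sigma_gen F) (fun w => v w ^+ 2) (fun=> 1).

Hypothesis mF : forall f, F f -> measurable_fun setT f.

Lemma sigma_gen_measurable A : sigma_gen F A -> measurable A.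
Proof.
apply: smallest_sub; first exact: sigma_algebra_measurable.
by move=> _ [f [/mF mf [B [mB ->]]]]; rewrite -[X in measurable X]setTI; exact: mf.
Qed.

Variable v : T -> R.
Hypothesis vw : white v.

Lemma white_measurable : measurable_fun setT v.
Proof. by case: vw => -[/measurable_int /measurable_EFinP]. Qed.

Let mv := white_measurable.

Lemma integral_sq_white (X : T -> R) : l2_wrt X ->
  (\int[mu]_w (X w ^+ 2 * v w ^+ 2)%:E = \int[mu]_w (X w ^+ 2)%:E)%E.
Proof.
move=> [GX [mX Xi]].
rewrite (@ge0_integral_weight _ _ _ mu (sigma_gen F) _ _ (fun=> 1)) //.
- by apply: eq_integral => w _; rewrite mulr1.
- by apply/meas_wrtP; apply: measurable_funX; exact/meas_wrtP.
- exact: measurable_funX.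
- by move=> w; exact: sqr_ge0.
- exact: measurable_funX.
- by move=> w; exact: sqr_ge0.
- by case: vw => _ [].
Qed.

Lemma sq_intM_white (X : T -> R) : l2_wrt X -> sq_int mu (fun w => v w * X w).
Proof.
move=> GX; have [_ [mX Xi]] := GX; split; first exact: measurable_funM.
apply/integrableP; split.
  by apply/measurable_EFinP; apply: measurable_funX; exact: measurable_funM.
under eq_integral do rewrite /= ger0_norm ?sqr_ge0 // mulrC exprMn.
rewrite integral_sq_white //; have /integrableP[_] := Xi.
by under eq_integral do rewrite /= ger0_norm ?sqr_ge0 //.
Qed.

Lemma Ex_sq_white (X : T -> R) : l2_wrt X ->
  Ex mu (fun w => X w ^+ 2 * v w ^+ 2) = Ex mu (fun w => X w ^+ 2).
Proof. by move=> GX; rewrite /Ex integral_sq_white. Qed.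

(* The sign-changing weight [v] is reached through [(1 + v) ^+ 2 >= 0], of conditional
   expectation 2. *)
Lemma Ex_sq_white1 (X : T -> R) : l2_wrt X -> Ex mu (fun w => X w ^+ 2 * v w) = 0.
Proof.
move=> GX; have [mGX [mX Xi]] := GX; have sX := sq_intM_white GX.
have Xvi : rintegrable mu (fun w => X w ^+ 2 * v w).
  rewrite (_ : (fun _ => _) = fun w => X w * (v w * X w)); first exact: sq_intM_int.
  by apply/funext => w; ring.
have Xvvi : rintegrable mu (fun w => X w ^+ 2 * v w ^+ 2).
  rewrite (_ : (fun _ => _) = fun w => (v w * X w) ^+ 2); first exact: sX.2.
  by apply/funext => w; ring.
have : Ex mu (fun w => X w ^+ 2 * (1 + v w) ^+ 2) = Ex mu (fun w => X w ^+ 2 * 2).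
  rewrite /Ex; congr fine; apply: (@ge0_integral_weight _ _ _ mu (sigma_gen F)) => //.
  - by apply/meas_wrtP; apply: measurable_funX; exact/meas_wrtP.
  - exact: measurable_funX.
  - by move=> w; exact: sqr_ge0.
  - by apply: measurable_funX; exact: measurable_funD.
  - by move=> w; exact: sqr_ge0.
  move=> A GA; have mA := sigma_gen_measurable GA.
  have [[vi _ _ v0] [vvi _ _ v1]] := vw.
  have iA f : rintegrable mu f -> mu.-integrable A (EFin \o f).
    by apply: integrableS.
  have i1 : mu.-integrable A (EFin \o fun=> 1 : R) by apply/iA/rintegrable_cst.
  transitivity (\int[mu]_(w in A) ((1 + 2 * v w)%:E + (v w ^+ 2)%:E))%E.
    by apply: eq_integral => w _; rewrite -EFinD; congr EFin; ring.
  rewrite integralD //; last 2 first.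
  - exact/iA/rintegrableD/rintegrableZ/vi/rintegrable_cst.
  - exact/iA/vvi.
  rewrite v1 //; under eq_integral do rewrite EFinD.
  rewrite integralD //; last exact/iA/rintegrableZ/vi.
  under [X in (_ + X + _)%E]eq_integral do rewrite EFinM.
  rewrite integralZl ?v0 //; last exact/iA/vi.
  rewrite [X in (_ * X)%E]integral0_eq // mule0 adde0 -integralD //.
rewrite (_ : (fun _ => _) =
  (fun w => X w ^+ 2 + (2 * (X w ^+ 2 * v w) + X w ^+ 2 * v w ^+ 2))); last first.
  by apply/funext => w; ring.
rewrite (_ : (fun w => _ * 2) = (fun w => 2 * X w ^+ 2)); last first.
  by apply/funext => w; ring.
rewrite !(ExD, ExZ) ?Ex_sq_white //; first lra; try exact: rintegrableZ.
exact/rintegrableD/Xvvi/rintegrableZ.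
Qed.

Section Polarization.
Variables X Y : T -> R.
Hypotheses (GX : l2_wrt X) (GY : l2_wrt Y).

Let polarize (c : T -> R) :
  (forall Z, l2_wrt Z -> rintegrable mu (fun w => Z w ^+ 2 * c w)) ->
  Ex mu (fun w => X w * Y w * c w)
  = 4^-1 * Ex mu (fun w => (X w + Y w) ^+ 2 * c w)
    + - 4^-1 * Ex mu (fun w => (X w + -1 * Y w) ^+ 2 * c w).
Proof.
move=> Zi; have Zp := Zi _ (l2_wrtD GX GY); have Zm := Zi _ (l2_wrtD GX (l2_wrtZ (-1) GY)).
rewrite -!ExZ // -ExD; try exact: rintegrableZ.
by congr Ex; apply/funext => w; field.
Qed.

Lemma Ex_white : Ex mu (fun w => X w * Y w * v w) = 0.
Proof.
rewrite polarize => [|Z GZ].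
  by rewrite !Ex_sq_white1 ?mulr0 ?addr0 //; do ?[apply: l2_wrtD|apply: l2_wrtZ].
rewrite (_ : (fun _ => _) = fun w => Z w * (v w * Z w)).
  exact: sq_intM_int GZ.2 (sq_intM_white GZ).
by apply/funext => w; ring.
Qed.

Lemma Ex_white_sq : Ex mu (fun w => X w * Y w * v w ^+ 2) = Ex mu (fun w => X w * Y w).
Proof.
have -> : (fun w => X w * Y w) = (fun w => X w * Y w * 1).
  by apply/funext => w; rewrite mulr1.
rewrite !polarize => [|Z [_ [_]]|Z GZ].
- rewrite !Ex_sq_white; do ?[apply: l2_wrtD|apply: l2_wrtZ] => //.
  by congr (_ * _ + _ * _); congr Ex; apply/funext => w; rewrite mulr1.
- by apply: eq_integrable => // w _ /=; rewrite mulr1.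
- rewrite (_ : (fun _ => _) = fun w => (v w * Z w) ^+ 2); first exact: (sq_intM_white GZ).2.
  by apply/funext => w; ring.
Qed.
End Polarization.
End Noise.

Section RandomVectors.
Context {R : realType} {d : measure_display} {T : measurableType d}.
Variable mu : probability T R.

Lemma sq_int_sum (I : Type) (r : seq I) (f : I -> T -> R) :
  (forall i, sq_int mu (f i)) -> sq_int mu (fun w => \sum_(i <- r) f i w).
Proof.
move=> Fi; elim: r => [|i r IH].
  by rewrite (_ : (fun _ => _) = fun=> 0) ?funeqE => [|w]; rewrite ?big_nil //; exact: sq_int_cst.
rewrite (_ : (fun _ => _) = fun w => f i w + \sum_(j <- r) f j w); last first.
  by apply/funext => w; rewrite big_cons.
exact: sq_intD.
Qed.

Lemma sq_int_vec_cst k (c : 'cV[R]_k) : sq_int_vec mu (fun=> c).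
Proof. by move=> i; exact: sq_int_cst. Qed.

Lemma sq_int_vecD k (X Y : T -> 'cV[R]_k) :
  sq_int_vec mu X -> sq_int_vec mu Y -> sq_int_vec mu (fun w => X w + Y w).
Proof.
move=> Xi Yi i; rewrite (_ : (fun w => _) = fun w => X w i 0 + Y w i 0).
  exact: sq_intD.
by apply/funext => w; rewrite mxE.
Qed.

Lemma sq_int_vec_mul k p (M : 'M[R]_(k, p)) (X : T -> 'cV[R]_p) :
  sq_int_vec mu X -> sq_int_vec mu (fun w => M *m X w).
Proof.
move=> Xi i; rewrite (_ : (fun w => _) = fun w => \sum_j M i j * X w j 0).
  by apply: sq_int_sum => j; exact: sq_intZ.
by apply/funext => w; rewrite mxE.
Qed.

Lemma Evec_cst k (c : 'cV[R]_k) : Evec mu (fun=> c) = c.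
Proof. by apply/matrixP => i j; rewrite mxE Ex_cst ord1. Qed.

Lemma EvecD k (X Y : T -> 'cV[R]_k) : sq_int_vec mu X -> sq_int_vec mu Y ->
  Evec mu (fun w => X w + Y w) = Evec mu X + Evec mu Y.
Proof.
move=> Xi Yi; apply/matrixP => i j; rewrite !mxE -ExD; try exact: sq_int_int.
by congr Ex; apply/funext => w; rewrite mxE.
Qed.

Lemma Evec_mul k p (M : 'M[R]_(k, p)) (X : T -> 'cV[R]_p) : sq_int_vec mu X ->
  Evec mu (fun w => M *m X w) = M *m Evec mu X.
Proof.
move=> Xi; apply/matrixP => i j; rewrite !mxE.
transitivity (Ex mu (fun w => \sum_j M i j * X w j 0)).
  by congr Ex; apply/funext => w; rewrite mxE.
rewrite Ex_sum => [|l]; last exact/rintegrableZ/sq_int_int.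
by apply: eq_bigr => l _; rewrite ExZ ?mxE //; exact: sq_int_int.
Qed.

Definition centered {k} (X : T -> 'cV[R]_k) w := X w - Evec mu X.

Lemma sq_int_vec_centered k (X : T -> 'cV[R]_k) :
  sq_int_vec mu X -> sq_int_vec mu (centered X).
Proof. by move=> Xi; apply: sq_int_vecD => //; exact: sq_int_vec_cst. Qed.

Lemma Evec_centered k (X : T -> 'cV[R]_k) : sq_int_vec mu X -> Evec mu (centered X) = 0.
Proof. by move=> Xi; rewrite EvecD ?Evec_cst ?subrr //; exact: sq_int_vec_cst. Qed.

Lemma bl_rintegrable k p (M : 'M[R]_(k, p)) X Y : sq_int_vec mu X -> sq_int_vec mu Y ->
  rintegrable mu (fun w => bl M (X w) (Y w)).
Proof.
move=> Xi Yi; under eq_fun do rewrite bl_sum.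
by do 2!apply: rintegrable_sum => ?; apply/rintegrableZ/sq_intM_int.
Qed.

Lemma Ex_bl k p (M : 'M[R]_(k, p)) X Y : sq_int_vec mu X -> sq_int_vec mu Y ->
  Ex mu (fun w => bl M (X w) (Y w)) =
  \sum_i \sum_j M i j * Ex mu (fun w => X w i 0 * Y w j 0).
Proof.
move=> Xi Yi; under eq_fun do rewrite bl_sum.
rewrite Ex_sum => [|i].
  apply: eq_bigr => i _; rewrite Ex_sum => [|j]; last exact/rintegrableZ/sq_intM_int.
  by apply: eq_bigr => j _; rewrite ExZ //; exact: sq_intM_int.
by apply: rintegrable_sum => j; exact/rintegrableZ/sq_intM_int.
Qed.

Lemma Ex_bl_cstr k p (M : 'M[R]_(k, p)) X c : sq_int_vec mu X ->
  Ex mu (fun w => bl M (X w) c) = bl M (Evec mu X) c.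
Proof.
move=> Xi; rewrite (@Ex_bl _ _ M X (fun=> c)) ?bl_sum //; last exact: sq_int_vec_cst.
apply: eq_bigr => i _; apply: eq_bigr => j _; rewrite mxE [X in _ = _ * X]mulrC.
rewrite -[c j 0 * _]ExZ; last exact: sq_int_int.
by congr (_ * Ex _ _); apply/funext => w; rewrite mulrC.
Qed.

Lemma Ex_bl_cstl k p (M : 'M[R]_(k, p)) c Y : sq_int_vec mu Y ->
  Ex mu (fun w => bl M c (Y w)) = bl M c (Evec mu Y).
Proof.
by move=> Yi; rewrite -blT -Ex_bl_cstr //; congr Ex; apply/funext => w; rewrite blT.
Qed.

Lemma Ex_bl_centered k p (M : 'M[R]_(k, p)) X Y : sq_int_vec mu X -> sq_int_vec mu Y ->
  Ex mu (fun w => bl M (X w) (Y w)) =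
  Ex mu (fun w => bl M (centered X w) (centered Y w)) + bl M (Evec mu X) (Evec mu Y).
Proof.
move=> Xi Yi; have Xc := sq_int_vec_centered Xi; have Yc := sq_int_vec_centered Yi.
transitivity (Ex mu (fun w => bl M (centered X w) (centered Y w) +
    (bl M (Evec mu X) (centered Y w) + bl M (X w) (Evec mu Y)))).
  congr Ex; apply/funext => w; rewrite addrA -blDl [centered X w]/centered subrK -blDr.
  by rewrite /centered subrK.
have cX := sq_int_vec_cst (Evec mu X); have cY := sq_int_vec_cst (Evec mu Y).
rewrite !ExD ?Ex_bl_cstl ?Ex_bl_cstr ?Evec_centered //; do ?apply: rintegrableD;
  try exact: bl_rintegrable.
by rewrite -blT bl0l add0r.
Qed.

Lemma Ex_qf_centered k (M : 'M[R]_k) X : sq_int_vec mu X ->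
  Ex mu (fun w => qf M (X w)) = Ex mu (fun w => qf M (centered X w)) + qf M (Evec mu X).
Proof. by move=> Xi; exact: Ex_bl_centered. Qed.

Lemma sqnorm_rintegrable k (X : T -> 'cV[R]_k) : sq_int_vec mu X ->
  rintegrable mu (fun w => sqnorm (X w)).
Proof. by move=> Xi; under eq_fun do rewrite sqnormE; exact: bl_rintegrable. Qed.

Definition l2_vec (F : set (T -> R)) {k} (X : T -> 'cV[R]_k) :=
  forall i, l2_wrt mu F (fun w => X w i 0).

Lemma l2_vec_sq_int F k (X : T -> 'cV[R]_k) : l2_vec F X -> sq_int_vec mu X.
Proof. by move=> Xi i; have [] := Xi i. Qed.

Lemma l2_vec_cst F k (c : 'cV[R]_k) : l2_vec F (fun=> c).
Proof. by move=> i; exact: l2_wrt_cst. Qed.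

Lemma l2_vecD F k (X Y : T -> 'cV[R]_k) :
  l2_vec F X -> l2_vec F Y -> l2_vec F (fun w => X w + Y w).
Proof.
move=> Xi Yi i; rewrite (_ : (fun w => _) = fun w => X w i 0 + Y w i 0).
  exact: l2_wrtD.
by apply/funext => w; rewrite mxE.
Qed.

Lemma l2_vec_mul F k p (M : 'M[R]_(k, p)) (X : T -> 'cV[R]_p) :
  l2_vec F X -> l2_vec F (fun w => M *m X w).
Proof.
move=> Xi i; rewrite (_ : (fun w => _) = fun w => \sum_j M i j * X w j 0).
  by apply: l2_wrt_sum => j; exact: l2_wrtZ.
by apply/funext => w; rewrite mxE.
Qed.

Lemma l2_vec_centered F k (X : T -> 'cV[R]_k) : l2_vec F X -> l2_vec F (centered X).
Proof. by move=> Xi; apply: l2_vecD => //; exact: l2_vec_cst. Qed.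

Lemma preimages_sub (F F' : set (T -> R)) : F `<=` F' -> preimages F `<=` preimages F'.
Proof. by move=> FF' A [f [/FF' Ff h]]; exists f. Qed.

Lemma meas_wrt_sub (F F' : set (T -> R)) (f : T -> R) : F `<=` F' ->
  meas_wrt (sigma_gen F) f -> meas_wrt (sigma_gen F') f.
Proof. by move=> FF' mf B mB; apply: (@sub_sigma_algebra2 _ setT _ _ (preimages_sub FF')); exact: mf. Qed.

Lemma meas_wrt_gen (F : set (T -> R)) (f : T -> R) : F f -> meas_wrt (sigma_gen F) f.
Proof. by move=> Ff B mB; apply: sub_sigma_algebra; exists f; split => //; exists B. Qed.

Section WhiteNoise.
Variables (F : set (T -> R)) (v : T -> R).
Hypotheses (mF : forall f, F f -> measurable_fun setT f) (vw : white mu F v).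
Variables (k : nat) (X Y : T -> 'cV[R]_k).
Hypotheses (GX : l2_vec F X) (GY : l2_vec F Y).

Let noisy w := X w + v w *: Y w.

Lemma sq_int_vecZ_white : sq_int_vec mu (fun w => v w *: Y w).
Proof.
move=> i; rewrite (_ : (fun w => _) = fun w => v w * Y w i 0).
  exact: (sq_intM_white vw (GY i)).
by apply/funext => w; rewrite mxE.
Qed.

Lemma l2_vec_white F' : F `<=` F' -> F' v -> l2_vec F' noisy.
Proof.
move=> FF' Fv i; split; last exact: (sq_int_vecD (l2_vec_sq_int GX) sq_int_vecZ_white).
rewrite (_ : (fun w => _) = fun w => X w i 0 + v w * Y w i 0); last first.
  by apply/funext => w; rewrite !mxE.
apply/meas_wrtP; apply: measurable_funD; last apply: measurable_funM; apply/meas_wrtP.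
- exact: meas_wrt_sub (GX i).1.
- exact: meas_wrt_gen.
- exact: meas_wrt_sub (GY i).1.
Qed.

Lemma Evec_white : Evec mu noisy = Evec mu X.
Proof.
rewrite EvecD; [|exact: l2_vec_sq_int GX|exact: sq_int_vecZ_white].
rewrite -[RHS]addr0; congr (_ + _); apply/matrixP => i j; rewrite !mxE.
rewrite -(Ex_white mF vw (l2_wrt_cst _ _ 1) (GY i)).
by congr Ex; apply/funext => w; rewrite mxE; ring.
Qed.

Lemma Ex_qf_white (M : 'M[R]_k) :
  Ex mu (fun w => qf M (noisy w)) = Ex mu (fun w => qf M (X w)) + Ex mu (fun w => qf M (Y w)).
Proof.
have iX := l2_vec_sq_int GX; have iY := l2_vec_sq_int GY; have ivY := sq_int_vecZ_white.
have cross U W : l2_vec F U -> l2_vec F W ->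
    Ex mu (fun w => bl M (U w) (W w) * v w) = 0.
  move=> GU GW; have iU := l2_vec_sq_int GU; have iW := l2_vec_sq_int GW.
  have ivU : sq_int_vec mu (fun w => v w *: U w).
    move=> i; rewrite (_ : (fun w => _) = fun w => v w * U w i 0).
      exact: (sq_intM_white vw (GU i)).
    by apply/funext => w; rewrite mxE.
  transitivity (Ex mu (fun w => bl M (v w *: U w) (W w))).
    by congr Ex; apply/funext => w; rewrite blZl mulrC.
  rewrite Ex_bl //; apply: big1 => i _; apply: big1 => j _.
  rewrite (_ : (fun w => _) = fun w => U w i 0 * W w j 0 * v w).
    by rewrite (Ex_white mF vw) ?mulr0.
  by apply/funext => w; rewrite mxE; ring.
transitivity (Ex mu (fun w => (qf M (X w) + bl M (v w *: Y w) (v w *: Y w)) +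
    (bl M (X w) (v w *: Y w) + bl M (v w *: Y w) (X w)))).
  by congr Ex; apply/funext => w; rewrite /noisy !qfE !(blDl, blDr); ring.
rewrite !ExD; do ?apply: rintegrableD; try exact: bl_rintegrable.
rewrite (_ : (fun w => bl M (X w) _) = fun w => bl M (X w) (Y w) * v w); last first.
  by apply/funext => w; rewrite blZr mulrC.
rewrite (_ : (fun w => bl M _ (X w)) = fun w => bl M (Y w) (X w) * v w); last first.
  by apply/funext => w; rewrite blZl mulrC.
rewrite !cross // !addr0; congr (_ + _); rewrite !Ex_bl //.
apply: eq_bigr => i _; apply: eq_bigr => j _; congr (_ * _).
rewrite -(Ex_white_sq vw (GY i) (GY j)).
by congr Ex; apply/funext => w; rewrite !mxE; ring.
Qed.
End WhiteNoise.
End RandomVectors.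

Section OneStep.
Context {R : realType} {d : measure_display} {T : measurableType d}.
Variable mu : probability T R.
Context {n m : nat} (sys : mflq R n m) (P Pi : nat -> 'M[R]_n).
Implicit Types (x : T -> 'cV[R]_n) (u : T -> 'cV[R]_m).

Definition mean_field_affine (M Mb : 'M[R]_n) (L Lb : 'M[R]_(n, m)) x u (w : T) : 'cV[R]_n :=
  M *m x w + Mb *m Evec mu x + L *m u w + Lb *m Evec mu u.

Definition next_state k (v : T -> R) x u (w : T) : 'cV[R]_n :=
  mean_field_affine (cA sys k) (cAb sys k) (cB sys k) (cBb sys k) x u w
  + v w *: mean_field_affine (cC sys k) (cCb sys k) (cD sys k) (cDb sys k) x u w.

Definition stage_cost k x u : R :=
  Ex mu (fun w => qf (cQ sys k) (x w) + 2 * bf (cS sys k) (u w) (x w) + qf (cR sys k) (u w))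
  + qf (cQb sys k) (Evec mu x)
  + 2 * bf (cSb sys k) (Evec mu u) (Evec mu x)
  + qf (cRb sys k) (Evec mu u).

Definition mean_field_qf (M Mb : 'M[R]_n) x : R :=
  Ex mu (fun w => qf M (centered mu x w)) + qf Mb (Evec mu x).

Definition riccatiP k : 'M[R]_n :=
  cQ sys k + (cA sys k)^T *m P k.+1 *m cA sys k
  + (cC sys k)^T *m P k.+1 *m cC sys k
  - (Hm sys P k)^T *m mpinv (Ups sys P k) *m Hm sys P k.

Definition riccatiPi k : 'M[R]_n :=
  cQ sys k + cQb sys k
  + (cA sys k + cAb sys k)^T *m Pi k.+1 *m (cA sys k + cAb sys k)
  + (cC sys k + cCb sys k)^T *m P k.+1 *m (cC sys k + cCb sys k)
  - (Hmb sys P Pi k)^T *m mpinv (Upsb sys P Pi k) *m Hmb sys P Pi k.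

Definition gain k : 'M[R]_(m, n) := invmx (Ups sys P k) *m Hm sys P k.
Definition mean_gain k : 'M[R]_(m, n) := invmx (Upsb sys P Pi k) *m Hmb sys P Pi k.

Definition residual k x u : R :=
  Ex mu (fun w => qf (Ups sys P k) (centered mu u w + gain k *m centered mu x w))
  + qf (Upsb sys P Pi k) (Evec mu u + mean_gain k *m Evec mu x).

Definition deviation k x u : R :=
  Ex mu (fun w => sqnorm (centered mu u w + gain k *m centered mu x w))
  + sqnorm (Evec mu u + mean_gain k *m Evec mu x).

Section MeanFieldAffine.
Variables (M Mb : 'M[R]_n) (L Lb : 'M[R]_(n, m)).
Variables (F : set (T -> R)) (x : T -> 'cV[R]_n) (u : T -> 'cV[R]_m).
Hypotheses (Gx : l2_vec mu F x) (Gu : l2_vec mu F u).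
Local Notation aff := (mean_field_affine M Mb L Lb x u).

Let ix := l2_vec_sq_int Gx.
Let iu := l2_vec_sq_int Gu.

Lemma l2_vec_affine : l2_vec mu F aff.
Proof.
by do ?apply: l2_vecD; do [exact: l2_vec_cst|exact: l2_vec_mul].
Qed.

Lemma Evec_affine : Evec mu aff = (M + Mb) *m Evec mu x + (L + Lb) *m Evec mu u.
Proof.
have cst k (c : 'cV[R]_k) := @sq_int_vec_cst _ _ _ mu _ c.
have iM := sq_int_vec_mul M ix; have iL := sq_int_vec_mul L iu.
rewrite /mean_field_affine !EvecD ?Evec_mul ?Evec_cst ?mulmxDl ?addrA //;
  by do ?apply: sq_int_vecD.
Qed.

Lemma centered_affine w :
  centered mu aff w = M *m centered mu x w + L *m centered mu u w.
Proof.
rewrite /centered Evec_affine /mean_field_affine !mulmxBr !mulmxDl.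
move: (M *m x w) (Mb *m _) (L *m u w) (Lb *m _) (M *m _) (L *m _) => a b c e f g.
by rewrite !opprD !addrA; apply/matrixP => i j; rewrite !mxE; ring.
Qed.
End MeanFieldAffine.

Section Step.
Variables (F F' : set (T -> R)) (v : T -> R) (k : nat).
Hypotheses (mF : forall f, F f -> measurable_fun setT f) (vw : white mu F v).
Variables (x : T -> 'cV[R]_n) (u : T -> 'cV[R]_m).
Hypotheses (Gx : l2_vec mu F x) (Gu : l2_vec mu F u).

Lemma l2_vec_next : F `<=` F' -> F' v -> l2_vec mu F' (next_state k v x u).
Proof. by move=> FF' Fv; apply: (l2_vec_white vw) => //; exact: l2_vec_affine. Qed.

Lemma Evec_next : Evec mu (next_state k v x u) =
  (cA sys k + cAb sys k) *m Evec mu x + (cB sys k + cBb sys k) *m Evec mu u.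
Proof. by rewrite (Evec_white mF vw) ?(Evec_affine _ _ _ _ Gx Gu) //; exact: l2_vec_affine. Qed.

Lemma Ex_qf_next (M : 'M[R]_n) :
  Ex mu (fun w => qf M (centered mu (next_state k v x u) w)) =
  Ex mu (fun w => qf M (cA sys k *m centered mu x w + cB sys k *m centered mu u w))
  + Ex mu (fun w => qf M (cC sys k *m centered mu x w + cD sys k *m centered mu u w))
  + qf M ((cC sys k + cCb sys k) *m Evec mu x + (cD sys k + cDb sys k) *m Evec mu u).
Proof.
set X := mean_field_affine (cA sys k) (cAb sys k) (cB sys k) (cBb sys k) x u.
set Y := mean_field_affine (cC sys k) (cCb sys k) (cD sys k) (cDb sys k) x u.
have GX : l2_vec mu F X by exact: l2_vec_affine.
have GY : l2_vec mu F Y by exact: l2_vec_affine.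
transitivity (Ex mu (fun w => qf M (centered mu X w + v w *: Y w))).
  congr Ex; apply/funext => w; congr qf; rewrite {1}/centered (Evec_white mF vw GX GY).
  by rewrite addrAC.
rewrite (Ex_qf_white mF vw (l2_vec_centered GX) GY) (Ex_qf_centered _ (l2_vec_sq_int GY)).
rewrite (Evec_affine _ _ _ _ Gx Gu) -[RHS]addrA.
congr (_ + (_ + _)); congr Ex.
  by apply/funext => w; rewrite (centered_affine _ _ _ _ Gx Gu).
by apply/funext => w; rewrite (centered_affine _ _ _ _ Gx Gu).
Qed.

Lemma stage_costE : stage_cost k x u =
  Ex mu (fun w => qf (cQ sys k) (centered mu x w)
    + 2 * bf (cS sys k) (centered mu u w) (centered mu x w)
    + qf (cR sys k) (centered mu u w))
  + (qf (cQ sys k + cQb sys k) (Evec mu x)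
    + 2 * bf (cS sys k + cSb sys k) (Evec mu u) (Evec mu x)
    + qf (cR sys k + cRb sys k) (Evec mu u)).
Proof.
have ix := l2_vec_sq_int Gx; have iu := l2_vec_sq_int Gu.
have cx := sq_int_vec_centered ix; have cu := sq_int_vec_centered iu.
have split X U : sq_int_vec mu X -> sq_int_vec mu U ->
    Ex mu (fun w => qf (cQ sys k) (X w) + 2 * bf (cS sys k) (U w) (X w) + qf (cR sys k) (U w))
    = Ex mu (fun w => bl (cQ sys k) (X w) (X w))
      + 2 * Ex mu (fun w => bl (cS sys k) (X w) (U w))
      + Ex mu (fun w => bl (cR sys k) (U w) (U w)).
  move=> iX iU; under eq_fun do rewrite bfE.
  rewrite !ExD ?ExZ //; try (by do ?apply: rintegrableD; do ?apply: rintegrableZ; exact: bl_rintegrable).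
rewrite /stage_cost !split // !(@Ex_bl_centered _ _ _ mu _ _ _ x) //.
rewrite !(@Ex_bl_centered _ _ _ mu _ _ _ u) //.
rewrite !qfE !bfE !blDm; ring.
Qed.

Hypotheses (Rs : (cR sys k)^T = cR sys k) (Rbs : (cRb sys k)^T = cRb sys k).
Hypotheses (Ps : (P k.+1)^T = P k.+1) (Pis : (Pi k.+1)^T = Pi k.+1).
Hypotheses (Uu : Ups sys P k \in unitmx) (Ubu : Upsb sys P Pi k \in unitmx).

Lemma value_step :
  stage_cost k x u + mean_field_qf (P k.+1) (Pi k.+1) (next_state k v x u)
  = mean_field_qf (riccatiP k) (riccatiPi k) x + residual k x u.
Proof.
have ix := l2_vec_sq_int Gx; have iu := l2_vec_sq_int Gu.
have cx := sq_int_vec_centered ix; have cu := sq_int_vec_centered iu.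
have blin := @bl_rintegrable _ _ _ mu.
have sumi p q (M : 'M[R]_(p, n)) (L : 'M[R]_(p, q)) (U : T -> 'cV[R]_q) :
    sq_int_vec mu U -> sq_int_vec mu (fun w => M *m centered mu x w + L *m U w).
  by move=> iU; apply: sq_int_vecD; exact: sq_int_vec_mul.
rewrite stage_costE /mean_field_qf Ex_qf_next Evec_next /residual.
have stoch :
  Ex mu (fun w => qf (cQ sys k) (centered mu x w)
    + 2 * bf (cS sys k) (centered mu u w) (centered mu x w)
    + qf (cR sys k) (centered mu u w))
  + (Ex mu (fun w => qf (P k.+1) (cA sys k *m centered mu x w + cB sys k *m centered mu u w))
  + Ex mu (fun w => qf (P k.+1) (cC sys k *m centered mu x w + cD sys k *m centered mu u w)))
  = Ex mu (fun w => qf (riccatiP k) (centered mu x w))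
  + Ex mu (fun w => qf (Ups sys P k) (centered mu u w + gain k *m centered mu x w)).
  have iux : sq_int_vec mu (fun w => centered mu u w + gain k *m centered mu x w).
    by apply: sq_int_vecD => //; exact: sq_int_vec_mul.
  rewrite -[RHS]ExD; [|exact: blin|exact: blin].
  transitivity (Ex mu (fun w => qf (cQ sys k) (centered mu x w)
    + 2 * bf (cS sys k) (centered mu u w) (centered mu x w)
    + qf (cR sys k) (centered mu u w)
    + qf (P k.+1) (cA sys k *m centered mu x w + cB sys k *m centered mu u w)
    + qf (P k.+1) (cC sys k *m centered mu x w + cD sys k *m centered mu u w))).
    have iq : rintegrable mu (fun w => qf (cQ sys k) (centered mu x w)
      + 2 * bf (cS sys k) (centered mu u w) (centered mu x w)
      + qf (cR sys k) (centered mu u w)).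
      under eq_fun do rewrite bfE.
      by do ?apply: rintegrableD; do ?apply: rintegrableZ; exact: blin.
    have iA := blin _ _ (P k.+1) _ _ (sumi _ _ (cA sys k) (cB sys k) _ cu)
      (sumi _ _ (cA sys k) (cB sys k) _ cu).
    have iC := blin _ _ (P k.+1) _ _ (sumi _ _ (cC sys k) (cD sys k) _ cu)
      (sumi _ _ (cC sys k) (cD sys k) _ cu).
    by rewrite [RHS]ExD ?[X in _ = X + _]ExD ?addrA //; exact: rintegrableD.
  congr Ex; apply/funext => w.
  by rewrite (@complete_square _ n m (cQ sys k) (cA sys k) (cC sys k) (cS sys k) (cB sys k) (cD sys k) (cR sys k)).
have det :
  qf (cQ sys k + cQb sys k) (Evec mu x)
    + 2 * bf (cS sys k + cSb sys k) (Evec mu u) (Evec mu x)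
    + qf (cR sys k + cRb sys k) (Evec mu u)
  + qf (Pi k.+1) ((cA sys k + cAb sys k) *m Evec mu x + (cB sys k + cBb sys k) *m Evec mu u)
  + qf (P k.+1) ((cC sys k + cCb sys k) *m Evec mu x + (cD sys k + cDb sys k) *m Evec mu u)
  = qf (riccatiPi k) (Evec mu x)
  + qf (Upsb sys P Pi k) (Evec mu u + mean_gain k *m Evec mu x).
  rewrite (@complete_square _ n m (cQ sys k + cQb sys k) (cA sys k + cAb sys k)
    (cC sys k + cCb sys k) (cS sys k + cSb sys k) (cB sys k + cBb sys k)
    (cD sys k + cDb sys k) (cR sys k + cRb sys k)) //; last by rewrite linearD /= Rs Rbs.
  by rewrite [(cS sys k + cSb sys k)^T]linearD /= addrA.
move: stoch det.
set e1 := Ex _ _; set e2 := Ex _ _; set e3 := Ex _ _; set e4 := Ex _ _; set e5 := Ex _ _.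
set q1 := qf _ _ + _ + _; set q2 := qf _ _; set q3 := qf _ _; set q4 := qf _ _; set q5 := qf _ _.
move=> stoch det; lra.
Qed.
End Step.
End OneStep.

Section ControlProblem.
Context {R : realType} {d : measure_display} {T : measurableType d}.
Variable mu : probability T R.
Context {n m : nat} (sys : mflq R n m) (N : nat) (om : nat -> T -> R).
Hypothesis mom : forall k, (k < N)%N -> measurable_fun setT (om k).

Section Trajectories.
Variables (l : nat) (xi : T -> 'cV[R]_n).
Hypotheses (ixi : sq_int_vec mu xi) (noise : noise_cond mu N om l xi).

Definition observed k : set (T -> R) := coords xi `|` noise_fam om l k.

Lemma observed_measurable k : (k <= N)%N ->
  forall f, observed k f -> measurable_fun setT f.
Proof.
move=> kN f [[i ->]|[j [/andP[_ jk] ->]]]; first exact: (ixi i).1.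
exact/mom/(leq_trans jk).
Qed.

Lemma observedS k : observed k `<=` observed k.+1.
Proof.
move=> f [?|[j [/andP[lj jk] ->]]]; [by left | right; exists j; split => //].
by rewrite lj ltnS ltnW.
Qed.

Lemma observed_noise k : (l <= k)%N -> observed k.+1 (om k).
Proof. by move=> lk; right; exists k; rewrite lk ltnS leqnn. Qed.

Lemma white_noise k : (l <= k < N)%N -> white mu (observed k) (om k).
Proof. by move=> /noise. Qed.

Lemma l2_vec_next_state k x u : (l <= k < N)%N ->
  l2_vec mu (observed k) x -> l2_vec mu (observed k) u ->
  l2_vec mu (observed k.+1) (next_state mu sys k (om k) x u).
Proof.
move=> lkN Gx Gu; have [lk _] := andP lkN.
exact: (l2_vec_next sys k (white_noise lkN) Gx Gu (@observedS k) (observed_noise lk)).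
Qed.

Lemma l2_vec_initial : l2_vec mu (observed l) xi.
Proof.
move=> i; split => //; apply: meas_wrt_gen; left; by exists i.
Qed.

Section Admissible.
Variable u : nat -> T -> 'cV[R]_m.
Hypothesis uad : ctrl_adm mu N om l xi u.
Local Notation x := (state mu sys om l xi u).

Lemma l2_vec_control k : (l <= k < N)%N -> l2_vec mu (observed k) (u k).
Proof. by move=> lkN i; exact: uad. Qed.

Lemma l2_vec_traj j : (l + j <= N)%N ->
  l2_vec mu (observed (l + j)) (traj mu sys om l xi u j).
Proof.
elim: j => [|j IH] ljN; first by rewrite addn0; exact: l2_vec_initial.
have lj : (l <= l + j < N)%N by rewrite leq_addr -addnS.
rewrite addnS; apply: (l2_vec_next_state lj); last exact: l2_vec_control.
by apply: IH; rewrite ltnW // -addnS.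
Qed.

Lemma stateS k : (l <= k)%N -> x k.+1 = next_state mu sys k (om k) (x k) (u k).
Proof. by move=> lk; rewrite /state subSn //= subnKC. Qed.

Lemma state_init : x l = xi.
Proof. by rewrite /state subnn. Qed.

Lemma l2_vec_state k : (l <= k <= N)%N -> l2_vec mu (observed k) (x k).
Proof. by case/andP=> lk kN; have := @l2_vec_traj (k - l); rewrite subnKC //; apply. Qed.

Lemma JE : (l <= N)%N -> J mu sys N om l xi u =
  \sum_(l <= k < N) stage_cost mu sys k (x k) (u k)
  + mean_field_qf mu (cG sys) (cG sys + cGb sys) (x N).
Proof.
move=> lN; have iN : sq_int_vec mu (x N) by apply: (l2_vec_sq_int (l2_vec_state _)); rewrite lN leqnn.
rewrite /J /mean_field_qf Ex_qf_centered // addrC; congr (_ + _).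
by rewrite [qf (_ + _) _]qfE blDm addrA.
Qed.

Section Decomposition.
Variables P Pi : nat -> 'M[R]_n.
Hypothesis sysR : forall k, (k < N)%N ->
  (cR sys k)^T = cR sys k /\ (cRb sys k)^T = cRb sys k.
Hypothesis Psym : forall k, (k <= N)%N -> (P k)^T = P k /\ (Pi k)^T = Pi k.
Hypothesis PN : P N = cG sys.
Hypothesis PiN : Pi N = cG sys + cGb sys.
Hypothesis Uunit : forall k, (k < N)%N ->
  Ups sys P k \in unitmx /\ Upsb sys P Pi k \in unitmx.

Lemma J_decomposition : (l < N)%N ->
  (forall k, (l < k < N)%N -> P k = riccatiP sys P k /\ Pi k = riccatiPi sys P Pi k) ->
  J mu sys N om l xi u = mean_field_qf mu (riccatiP sys P l) (riccatiPi sys P Pi l) xi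
  + \sum_(l <= k < N) residual mu sys P Pi k (x k) (u k).
Proof.
move=> lN ric; rewrite JE ?(ltnW lN) // -PiN -PN.
pose W k := mean_field_qf mu (P k) (Pi k) (x k).
pose W' k := mean_field_qf mu (riccatiP sys P k) (riccatiPi sys P Pi k) (x k).
have step k : (l <= k < N)%N -> stage_cost mu sys k (x k) (u k) + W k.+1 =
    W' k + residual mu sys P Pi k (x k) (u k).
  move=> lkN; have [lk kN] := andP lkN.
  have [Rs Rbs] := sysR kN; have [Ps Pis] := Psym kN; have [Uu Ubu] := Uunit kN.
  rewrite /W stateS //; apply: (value_step (observed_measurable (ltnW kN)) (white_noise lkN)) => //.
    by apply: l2_vec_state; rewrite lk ltnW.
  exact: l2_vec_control.
have tele : \sum_(l <= k < N) (W k.+1 - W k) = W N - W l by apply: telescope_sumr; rewrite ltnW.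
have -> : mean_field_qf mu (P N) (Pi N) (x N) = \sum_(l <= k < N) (W k.+1 - W k) + W l.
  by rewrite tele subrK.
rewrite addrA -big_split /=.
rewrite (eq_big_nat _ _ (F2 := fun k => residual mu sys P Pi k (x k) (u k) + (W' k - W k))); last first.
  by move=> k /step e; rewrite addrA e; ring.
have sumW : \sum_(l <= k < N) (W' k - W k) = W' l - W l.
  rewrite big_ltn // big1_seq ?addr0 // => k; rewrite mem_index_iota /= => lkN.
  by have [eP ePi] := ric _ lkN; rewrite /W /W' -eP -ePi subrr.
by rewrite big_split /= sumW /W' state_init; ring.
Qed.

Lemma residual_ge a k : mx_ge_scalar (Ups sys P k) a -> mx_ge_scalar (Upsb sys P Pi k) a ->
  (l <= k < N)%N ->
  a * deviation mu sys P Pi k (x k) (u k) <= residual mu sys P Pi k (x k) (u k).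
Proof.
move=> /mx_ge_scalarP Ua /mx_ge_scalarP Uba lkN; have [lk kN] := andP lkN.
have ic : sq_int_vec mu (fun w => centered mu (u k) w + gain sys P k *m centered mu (x k) w).
  apply: sq_int_vecD; last apply: sq_int_vec_mul; apply: sq_int_vec_centered.
    exact: l2_vec_sq_int (l2_vec_control lkN).
  by apply: (l2_vec_sq_int (l2_vec_state _)); rewrite lk ltnW.
rewrite mulrDr -ExZ; last exact: sqnorm_rintegrable.
apply: lerD => //; apply: Ex_le => //; last exact: bl_rintegrable.
exact/rintegrableZ/sqnorm_rintegrable.
Qed.
End Decomposition.
End Admissible.

Section Feedback.
Variables P Pi : nat -> 'M[R]_n.

Definition feedback_law k (x : T -> 'cV[R]_n) w : 'cV[R]_m :=
  (- gain sys P k) *m centered mu x w + (- mean_gain sys P Pi k) *m Evec mu x.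

Fixpoint closed_loop j : T -> 'cV[R]_n :=
  if j is j'.+1 then
    next_state mu sys (l + j') (om (l + j')) (closed_loop j')
      (feedback_law (l + j') (closed_loop j'))
  else xi.

Definition feedback k := feedback_law k (closed_loop (k - l)).

Lemma l2_vec_feedback_law F k x : l2_vec mu F x -> l2_vec mu F (feedback_law k x).
Proof.
move=> Gx; apply: l2_vecD; last exact: l2_vec_cst.
exact/l2_vec_mul/l2_vec_centered.
Qed.

Lemma l2_vec_closed_loop j : (l + j <= N)%N ->
  l2_vec mu (observed (l + j)) (closed_loop j).
Proof.
elim: j => [|j IH] ljN; first by rewrite addn0; exact: l2_vec_initial.
have lj : (l <= l + j < N)%N by rewrite leq_addr -addnS.
have Gj : l2_vec mu (observed (l + j)) (closed_loop j).
  by apply: IH; rewrite ltnW // -addnS.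
rewrite addnS; apply: (l2_vec_next_state lj) => //; exact: l2_vec_feedback_law.
Qed.

Lemma feedback_adm : ctrl_adm mu N om l xi feedback.
Proof.
move=> k /andP[lk kN] i.
have := @l2_vec_closed_loop (k - l); rewrite subnKC // => /(_ (ltnW kN)) Gx.
exact: l2_vec_feedback_law.
Qed.

Lemma state_feedback k : state mu sys om l xi feedback k = closed_loop (k - l).
Proof.
rewrite /state; elim: (k - l)%N => [//|j IH] /=.
by rewrite IH /feedback addKn.
Qed.

Lemma residual_feedback k : (l <= k < N)%N ->
  residual mu sys P Pi k (state mu sys om l xi feedback k) (feedback k) = 0.
Proof.
move=> /andP[lk kN]; rewrite state_feedback /feedback; set x := closed_loop _.
have ix : sq_int_vec mu x.
  have := @l2_vec_closed_loop (k - l); rewrite subnKC // => /(_ (ltnW kN)).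
  exact: l2_vec_sq_int.
have icx := sq_int_vec_centered ix.
have EU : Evec mu (feedback_law k x) = - mean_gain sys P Pi k *m Evec mu x.
  rewrite /feedback_law EvecD ?Evec_mul ?Evec_centered ?Evec_cst ?mulmx0 ?add0r //;
    by [exact: sq_int_vec_cst|exact: sq_int_vec_mul].
rewrite /residual EU mulNmx addNr qfE bl0l addr0.
rewrite (_ : (fun w => _) = fun=> 0) ?Ex_cst //; apply/funext => w.
by rewrite {1}/centered EU /feedback_law addrK mulNmx addNr qfE bl0l.
Qed.
End Feedback.

End Trajectories.

Section Value.
Variables (P Pi : nat -> 'M[R]_n) (alpha : R).
Hypothesis sysR : forall k, (k < N)%N ->
  (cR sys k)^T = cR sys k /\ (cRb sys k)^T = cRb sys k.
Hypothesis Psym : forall k, (k <= N)%N -> (P k)^T = P k /\ (Pi k)^T = Pi k.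
Hypothesis PN : P N = cG sys.
Hypothesis PiN : Pi N = cG sys + cGb sys.
Hypothesis alpha0 : 0 < alpha.
Hypothesis Uge : forall k, (k < N)%N ->
  mx_ge_scalar (Ups sys P k) alpha /\ mx_ge_scalar (Upsb sys P Pi k) alpha.

Lemma weights_unit k : (k < N)%N ->
  Ups sys P k \in unitmx /\ Upsb sys P Pi k \in unitmx.
Proof. by move=> /Uge[U Ub]; split; exact: mx_ge_scalar_unit alpha0 _. Qed.

Lemma V_riccati l xi : (l < N)%N -> sq_int_vec mu xi -> noise_cond mu N om l xi ->
  (forall k, (l < k < N)%N -> P k = riccatiP sys P k /\ Pi k = riccatiPi sys P Pi k) ->
  V mu sys N om l xi =
    (mean_field_qf mu (riccatiP sys P l) (riccatiPi sys P Pi l) xi)%:E.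
Proof.
move=> lN ixi noise ric.
have dec u (uad : ctrl_adm mu N om l xi u) :=
  J_decomposition ixi noise uad sysR Psym PN PiN weights_unit lN ric.
apply/eqP; rewrite eq_le; apply/andP; split; last first.
  apply: le_ereal_inf_tmp => _ [u uad <-]; rewrite lee_fin dec // lerDl big_nat.
  apply: sumr_ge0 => k lkN; have [_ kN] := andP lkN; have [Ua Uba] := Uge kN.
  apply: le_trans (residual_ge ixi noise uad Ua Uba lkN).
  rewrite mulr_ge0 ?(ltW alpha0) // addr_ge0 ?sqnorm_ge0 //.
  by apply: Ex_ge0 => w; exact: sqnorm_ge0.
have fad := feedback_adm ixi noise P Pi.
have -> : mean_field_qf mu (riccatiP sys P l) (riccatiPi sys P Pi l) xi =
    J mu sys N om l xi (feedback l xi P Pi).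
  rewrite dec // big_nat big1 ?addr0 // => k lkN; exact: residual_feedback.
by apply: ereal_inf_lbound; exists (feedback l xi P Pi).
Qed.
End Value.
End ControlProblem.

Section TestStates.
Context {R : realType} {d : measure_display} {T : measurableType d}.
Variable mu : probability T R.
Context {n : nat} (N : nat) (om : nat -> T -> R).

Lemma sigma_gen_min (F F' : set (T -> R)) :
  (forall f, F f -> meas_wrt (sigma_gen F') f) -> sigma_gen F `<=` sigma_gen F'.
Proof.
move=> FF'; apply: smallest_sub; first exact: smallest_sigma_algebra.
by move=> _ [f [Ff [B [mB ->]]]]; exact: FF'.
Qed.

Lemma noise_fam_sub l : noise_fam om l N `<=` noise_fam om 0 N.
Proof. by move=> f [j [/andP[_ jN] ->]]; exists j. Qed.

Variable eta : T -> 'cV[R]_n.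
Hypothesis ieta : sq_int_vec mu eta.
Hypothesis eta_indep : indep mu (coords eta) (noise_fam om 0 N).

Lemma init_adm_affine l i (v c : 'cV[R]_n) :
  init_adm mu N om l (fun w => eta w i 0 *: v + c).
Proof.
have Gxi : l2_vec mu (coords eta) (fun w => eta w i 0 *: v + c).
  move=> j; rewrite (_ : (fun w => _) = fun w => v j 0 * eta w i 0 + c j 0).
    apply: l2_wrtD; last exact: l2_wrt_cst.
    by apply: l2_wrtZ; split => //; apply: meas_wrt_gen; exists i.
  by apply/funext => w; rewrite !mxE mulrC.
split; first exact: l2_vec_sq_int Gxi.
move=> A B GA GB; apply: eta_indep.
  by apply: sigma_gen_min GA => _ [j ->]; have [] := Gxi j.
by apply: sigma_gen_min GB => f /noise_fam_sub ?; exact: meas_wrt_gen.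
Qed.

Hypothesis eta0 : Evec mu eta = 0.
Hypothesis eta1 : forall i j, Ex mu (fun w => eta w i 0 * eta w j 0) = (i == j)%:R.

Lemma mean_field_qf_affine i (v c : 'cV[R]_n) (M Mb : 'M[R]_n) :
  mean_field_qf mu M Mb (fun w => eta w i 0 *: v + c) = qf M v + qf Mb c.
Proof.
have iv : sq_int_vec mu (fun w => eta w i 0 *: v).
  move=> j; rewrite (_ : (fun w => _) = fun w => v j 0 * eta w i 0); first exact: sq_intZ.
  by apply/funext => w; rewrite mxE mulrC.
have Ev : Evec mu (fun w => eta w i 0 *: v) = 0.
  apply/matrixP => j l; rewrite !mxE -[RHS](mulr0 (v j 0)).
  have <- : Evec mu eta i 0 = 0 by rewrite eta0 mxE.
  rewrite mxE -ExZ; last exact: sq_int_int.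
  by congr Ex; apply/funext => w; rewrite mxE mulrC.
have Exi : Evec mu (fun w => eta w i 0 *: v + c) = c.
  by rewrite EvecD ?Ev ?Evec_cst ?add0r //; exact: sq_int_vec_cst.
rewrite /mean_field_qf Exi; congr (_ + _).
transitivity (Ex mu (fun w => qf M v * (eta w i 0 * eta w i 0))).
  by congr Ex; apply/funext => w; rewrite /centered Exi addrK !qfE blZl blZr; ring.
by rewrite ExZ ?eta1 ?eqxx ?mulr1 //; exact: sq_intM_int.
Qed.

Lemma mean_field_qf_inj (i : 'I_n) (M M' Mb Mb' : 'M[R]_n) :
  M^T = M -> M'^T = M' -> Mb^T = Mb -> Mb'^T = Mb' ->
  (forall v c, mean_field_qf mu M Mb (fun w => eta w i 0 *: v + c) =
               mean_field_qf mu M' Mb' (fun w => eta w i 0 *: v + c)) ->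
  M = M' /\ Mb = Mb'.
Proof.
move=> s s' sb sb' e.
have q0 (L : 'M[R]_n) : qf L 0 = 0 by rewrite qfE bl0l.
split; apply: qf_inj => // x.
  by have := e x 0; rewrite !mean_field_qf_affine !q0 !addr0.
by have := e 0 x; rewrite !mean_field_qf_affine !q0 !add0r.
Qed.
End TestStates.

Section RiccatiSymmetry.
Context {R : realType} {n m : nat} (sys : mflq R n m) (P Pi : nat -> 'M[R]_n) (k : nat).
Hypotheses (Qs : (cQ sys k)^T = cQ sys k) (Qbs : (cQb sys k)^T = cQb sys k).
Hypotheses (Rs : (cR sys k)^T = cR sys k) (Rbs : (cRb sys k)^T = cRb sys k).
Hypotheses (Ps : (P k.+1)^T = P k.+1) (Pis : (Pi k.+1)^T = Pi k.+1).
Hypotheses (Uu : Ups sys P k \in unitmx) (Ubu : Upsb sys P Pi k \in unitmx).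

Let quad_sym p q (M : 'M[R]_p) (A : 'M[R]_(p, q)) : M^T = M ->
  (A^T *m M *m A)^T = A^T *m M *m A.
Proof. by move=> s; rewrite !trmx_mul trmxK s mulmxA. Qed.

Let symD p (M M' : 'M[R]_p) : M^T = M -> M'^T = M' -> (M + M')^T = M + M'.
Proof. by move=> s s'; rewrite linearD /= s s'. Qed.

Let symN p (M : 'M[R]_p) : M^T = M -> (- M)^T = - M.
Proof. by move=> s; rewrite linearN /= s. Qed.

Let symV p (M : 'M[R]_p) : M \in unitmx -> M^T = M -> (mpinv M)^T = mpinv M.
Proof. by move=> u s; rewrite mpinv_unit // trmx_inv s. Qed.

Lemma riccatiP_sym : (riccatiP sys P k)^T = riccatiP sys P k.
Proof.
apply: symD; last by apply/symN/quad_sym/symV => //; do ?apply: symD => //; exact: quad_sym.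
by do ?apply: symD => //; exact: quad_sym.
Qed.

Lemma riccatiPi_sym : (riccatiPi sys P Pi k)^T = riccatiPi sys P Pi k.
Proof.
apply: symD; last by apply/symN/quad_sym/symV => //; do ?apply: symD => //; exact: quad_sym.
by do ?apply: symD => //; exact: quad_sym.
Qed.
End RiccatiSymmetry.

Section Coercivity.
Context {R : realType} {d : measure_display} {T : measurableType d}.
Variable mu : probability T R.
Context {n m : nat} (sys : mflq R n m) (N : nat) (om : nat -> T -> R).
Hypothesis mom : forall k, (k < N)%N -> measurable_fun setT (om k).
Variables (xi : T -> 'cV[R]_n) (P Pi : nat -> 'M[R]_n).
Hypotheses (ixi : sq_int_vec mu xi) (noise : noise_cond mu N om 0 xi).
Hypothesis xi0 : Ex mu (fun w => sqnorm (xi w)) = 0.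

Lemma sqnorm_affine_le p q r (M : 'M[R]_(p, q)) (L : 'M[R]_(p, r)) :
  exists2 c : R, 0 <= c & forall x u, sqnorm (M *m x + L *m u) <= c * (sqnorm x + sqnorm u).
Proof.
have [a a0 Ma] := sqnorm_mul_le M; have [b b0 Lb] := sqnorm_mul_le L.
exists (2 * a + 2 * b); first lra.
move=> x u; apply: le_trans (sqnormD_le _ _) _.
have := Ma x; have := Lb u; have := sqnorm_ge0 x; have := sqnorm_ge0 u.
set s := sqnorm x; set t := sqnorm u => t0 s0 h1 h2.
have := mulr_ge0 a0 t0; have := mulr_ge0 b0 s0; lra.
Qed.

Lemma Ex_sqnorm_affine_le p q r (M : 'M[R]_(p, q)) (L : 'M[R]_(p, r)) :
  exists2 c : R, 0 <= c & forall X U, sq_int_vec mu X -> sq_int_vec mu U ->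
  Ex mu (fun w => sqnorm (M *m X w + L *m U w))
  <= c * (Ex mu (fun w => sqnorm (X w)) + Ex mu (fun w => sqnorm (U w))).
Proof.
have [c c0 h] := sqnorm_affine_le M L; exists c => // X U iX iU.
rewrite -ExD -?ExZ; try exact: sqnorm_rintegrable; last first.
  by apply: rintegrableD; exact: sqnorm_rintegrable.
apply: Ex_le => //.
  by apply: sqnorm_rintegrable; apply: sq_int_vecD; exact: sq_int_vec_mul.
by apply/rintegrableZ/rintegrableD; exact: sqnorm_rintegrable.
Qed.

Let energy k (X : T -> 'cV[R]_k) := Ex mu (fun w => sqnorm (X w)).

Lemma Ex_sqnorm_ge0 k (X : T -> 'cV[R]_k) : 0 <= Ex mu (fun w => sqnorm (X w)).
Proof. by apply: Ex_ge0 => w; exact: sqnorm_ge0. Qed.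

Lemma Ex_sqnorm_qf k (X : T -> 'cV[R]_k) :
  Ex mu (fun w => sqnorm (X w)) = Ex mu (fun w => qf 1%:M (X w)).
Proof. by congr Ex; apply/funext => w; rewrite sqnormE. Qed.

Lemma Ex_sqnorm_centered k (X : T -> 'cV[R]_k) : sq_int_vec mu X ->
  energy X = energy (centered mu X) + sqnorm (Evec mu X).
Proof. by move=> iX; rewrite /energy !Ex_sqnorm_qf sqnormE Ex_qf_centered. Qed.

Lemma deviation_ge0 k x u : 0 <= deviation mu sys P Pi k x u.
Proof. by rewrite addr_ge0 ?sqnorm_ge0 // Ex_sqnorm_ge0. Qed.

Lemma energy_next_le k : exists2 c : R, 0 <= c & forall F v x u,
  (forall f, F f -> measurable_fun setT f) -> white mu F v ->
  l2_vec mu F x -> l2_vec mu F u ->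
  energy (next_state mu sys k v x u) <= c * (energy x + energy u).
Proof.
have [a a0 ha] := Ex_sqnorm_affine_le (cA sys k) (cB sys k).
have [b b0 hb] := Ex_sqnorm_affine_le (cC sys k) (cD sys k).
have [a' a'0 ha'] := sqnorm_affine_le (cA sys k + cAb sys k) (cB sys k + cBb sys k).
have [b' b'0 hb'] := sqnorm_affine_le (cC sys k + cCb sys k) (cD sys k + cDb sys k).
exists (a + b + a' + b'); first lra.
move=> F v x u mF vw Gx Gu.
have ix := l2_vec_sq_int Gx; have iu := l2_vec_sq_int Gu.
have iy : sq_int_vec mu (next_state mu sys k v x u).
  apply: (@l2_vec_sq_int _ _ _ mu (F `|` [set v])).
  by apply: (l2_vec_next sys k vw Gx Gu); [left|right].
rewrite (Ex_sqnorm_centered iy) (Ex_sqnorm_centered ix) (Ex_sqnorm_centered iu) (Evec_next _ _ mF vw Gx Gu).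
rewrite [energy (centered mu (next_state _ _ _ _ _ _))]Ex_sqnorm_qf (Ex_qf_next _ _ mF vw Gx Gu).
rewrite -!Ex_sqnorm_qf -sqnormE.
have := ha _ _ (sq_int_vec_centered ix) (sq_int_vec_centered iu).
have := hb _ _ (sq_int_vec_centered ix) (sq_int_vec_centered iu).
have := ha' (Evec mu x) (Evec mu u); have := hb' (Evec mu x) (Evec mu u).
have := Ex_sqnorm_ge0 (centered mu x); have := Ex_sqnorm_ge0 (centered mu u).
have := sqnorm_ge0 (Evec mu x); have := sqnorm_ge0 (Evec mu u); rewrite /energy.
move: (Ex mu (fun w => sqnorm (centered mu x w))) (Ex mu (fun w => sqnorm (centered mu u w))).
move: (sqnorm (Evec mu x)) (sqnorm (Evec mu u)) => xb ub xc uc ub0 xb0 uc0 xc0 h1 h2 h3 h4.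
have := mulr_ge0 (addr_ge0 a0 b0) (addr_ge0 xb0 ub0).
have := mulr_ge0 (addr_ge0 a'0 b'0) (addr_ge0 xc0 uc0).
lra.
Qed.

Lemma energy_input_le k : exists2 c : R, 0 <= c & forall x u,
  sq_int_vec mu x -> sq_int_vec mu u ->
  energy u <= 2 * deviation mu sys P Pi k x u + c * energy x.
Proof.
have [a a0 ha] := sqnorm_mul_le (- gain sys P k).
have [b b0 hb] := sqnorm_mul_le (- mean_gain sys P Pi k).
exists (2 * a + 2 * b); first lra.
move=> x u ix iu; have cx := sq_int_vec_centered ix; have cu := sq_int_vec_centered iu.
have bound (p q : nat) (K : 'M[R]_(p, q)) (c : R) (y : 'cV[R]_p) (z : 'cV[R]_q) :
    (forall z, sqnorm (- K *m z) <= c * sqnorm z) ->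
    sqnorm y <= 2 * sqnorm (y + K *m z) + 2 * c * sqnorm z.
  move=> hK; rewrite -[y in leLHS](addrK (K *m z)) -mulNmx.
  apply: le_trans (sqnormD_le _ _) _; have := hK z; lra.
have hb2 := bound _ _ _ _ (Evec mu u) (Evec mu x) hb.
have ha2 : energy (centered mu u) <= Ex mu (fun w =>
    2 * sqnorm (centered mu u w + gain sys P k *m centered mu x w)
    + 2 * a * sqnorm (centered mu x w)).
  apply: Ex_le => [||w]; [exact: sqnorm_rintegrable| |exact: bound].
  apply: rintegrableD; apply: rintegrableZ; apply: sqnorm_rintegrable => //.
  by apply: sq_int_vecD => //; exact: sq_int_vec_mul.
have icK : sq_int_vec mu (fun w => centered mu u w + gain sys P k *m centered mu x w).
  by apply: sq_int_vecD => //; exact: sq_int_vec_mul.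
have i1 := sqnorm_rintegrable icK; have i2 := sqnorm_rintegrable cx.
move: ha2; rewrite ExD ?ExZ //; try exact: rintegrableZ.
rewrite (Ex_sqnorm_centered ix) (Ex_sqnorm_centered iu) /deviation.
have := mulr_ge0 a0 (sqnorm_ge0 (Evec mu x)).
have := mulr_ge0 b0 (Ex_sqnorm_ge0 (centered mu x)); rewrite /energy; lra.
Qed.

Local Notation total u :=
  (\sum_(i < N) deviation mu sys P Pi i (state mu sys om 0 xi u i) (u i)).

Lemma deviation_le_total u k : (k < N)%N ->
  deviation mu sys P Pi k (state mu sys om 0 xi u k) (u k) <= total u.
Proof.
move=> kN; rewrite (bigD1 (Ordinal kN)) //= lerDl sumr_ge0 // => i _.
exact: deviation_ge0.
Qed.

Lemma energy_state_le k : (k <= N)%N -> exists2 c : R, 0 <= c &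
  forall u, ctrl_adm mu N om 0 xi u -> energy (state mu sys om 0 xi u k) <= c * total u.
Proof.
elim: k => [|k IH] kN.
  exists 0 => // u _; rewrite mul0r.
  by have <- := xi0.
have [c c0 hc] := IH (ltnW kN).
have [a a0 ha] := energy_next_le k; have [b b0 hb] := energy_input_le k.
exists (a * (c + (2 + b * c))).
  by rewrite mulr_ge0 // addr_ge0 // addr_ge0 // mulr_ge0.
move=> u uad; rewrite stateS //.
have Gx : l2_vec mu (observed om 0 xi k) (state mu sys om 0 xi u k).
  by apply: (l2_vec_state sys ixi noise uad); rewrite (ltnW kN).
have Gu : l2_vec mu (observed om 0 xi k) (u k) by apply: (l2_vec_control uad).
have mF : forall f, observed om 0 xi k f -> measurable_fun setT f.
  exact: observed_measurable (ltnW kN).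
have lk : (0 <= k < N)%N by [].
apply: le_trans (ha _ _ _ _ mF (white_noise noise lk) Gx Gu) _.
rewrite -mulrA ler_wpM2l // mulrDl lerD ?hc //.
apply: le_trans (hb _ _ (l2_vec_sq_int Gx) (l2_vec_sq_int Gu)) _.
rewrite [leRHS]mulrDl -mulrA lerD // ler_wpM2l //; [exact: deviation_le_total|exact: hc].
Qed.

Lemma energy_control_le : exists2 c : R, 0 <= c &
  forall u, ctrl_adm mu N om 0 xi u ->
  Ex mu (fun w => \sum_(k < N) sqnorm (u k w)) <= c * total u.
Proof.
suff [c c0 hc] : exists2 c : R, 0 <= c & forall u, ctrl_adm mu N om 0 xi u ->
    \sum_(0 <= k < N) energy (u k) <= c * total u.
  exists c => // u uad; rewrite Ex_sum => [|k]; first by have := hc u uad; rewrite big_mkord.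
  have kN : (0 <= k < N)%N by rewrite leq0n ltn_ord.
  by apply: sqnorm_rintegrable; exact: l2_vec_sq_int (l2_vec_control uad kN).
elim: {1 4}N (leqnn N) => [_|k IH kN].
  by exists 0 => // u _; rewrite big_geq // mul0r.
have [c c0 hc] := IH (ltnW kN).
have [a a0 ha] := energy_state_le (ltnW kN); have [b b0 hb] := energy_input_le k.
exists (c + (2 + b * a)); first by rewrite !addr_ge0 // mulr_ge0.
move=> u uad; rewrite big_nat_recr //= mulrDl lerD ?hc //.
have Gx : l2_vec mu (observed om 0 xi k) (state mu sys om 0 xi u k).
  by apply: (l2_vec_state sys ixi noise uad); rewrite (ltnW kN).
have Gu : l2_vec mu (observed om 0 xi k) (u k) by apply: (l2_vec_control uad).
apply: le_trans (hb _ _ (l2_vec_sq_int Gx) (l2_vec_sq_int Gu)) _.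
rewrite [leRHS]mulrDl -mulrA lerD // ler_wpM2l //; [exact: deviation_le_total|exact: ha].
Qed.
End Coercivity.

Theorem theorem5p2 (R : realType) (d : measure_display) (T : measurableType d)
  (mu : probability T R) (n m N : nat) (sys : mflq R n m) (om : nat -> T -> R)
  (P Pi : nat -> 'M[R]_n) (alpha : R) :
  (0 < N)%N -> (0 < n)%N -> (0 < m)%N ->
  (* complete probability space, real random variables omega_0, ..., omega_(N-1) *)
  measure_is_complete mu ->
  (forall k, (k < N)%N -> measurable_fun setT (om k)) ->
  (* symmetric weights *)
  (forall k, (k < N)%N ->
     [/\ (cQ sys k)^T = cQ sys k, (cQb sys k)^T = cQb sys k,
         (cR sys k)^T = cR sys k & (cRb sys k)^T = cRb sys k]) ->
  (cG sys)^T = cG sys -> (cGb sys)^T = cGb sys ->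
  (* standing conditional moment conditions on the noise, for every initial pair *)
  (forall l (xi : T -> 'cV[R]_n), (l < N)%N -> init_adm mu N om l xi -> noise_cond mu N om l xi) ->
  (* the space carries initial states independent of the noise (see NOTES.md) *)
  (exists eta : T -> 'cV[R]_n,
     [/\ sq_int_vec mu eta, indep mu (coords eta) (noise_fam om 0 N),
         Evec mu eta = 0 &
         forall i j, Ex mu (fun w => eta w i 0 * eta w j 0) = (i == j)%:R]) ->
  (* Problem (MF-LQ)^0 is finite *)
  (forall l (xi : T -> 'cV[R]_n), (l < N)%N -> init_adm mu N om l xi -> (-oo < V mu sys N om l xi)%E) ->
  (* symmetric P_k, Pi_k representing the value function *)
  (forall k, (k < N)%N -> (P k)^T = P k /\ (Pi k)^T = Pi k) ->
  (forall l (xi : T -> 'cV[R]_n), (l < N)%N -> init_adm mu N om l xi ->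
     V mu sys N om l xi =
       (Ex mu (fun w => qf (P l) (xi w - Evec mu xi)) + qf (Pi l) (Evec mu xi))%:E) ->
  P N = cG sys -> Pi N = cG sys + cGb sys ->
  0 < alpha ->
  (forall k, (k < N)%N ->
     mx_ge_scalar (Ups sys P k) alpha /\ mx_ge_scalar (Upsb sys P Pi k) alpha) ->
  GRE_solution sys N P Pi /\
  (exists alpha' : R, 0 < alpha' /\
     forall u : nat -> T -> 'cV[R]_m, ctrl_adm mu N om 0 (fun _ => 0 : 'cV[R]_n) u ->
       alpha' * Ex mu (fun w => \sum_(k < N) sqnorm (u k w))
         <= J mu sys N om 0 (fun _ => 0 : 'cV[R]_n) u).
Proof.
move=> N0 n0 m0 _ mom sysS Gs Gbs noise [eta [ieta eta_indep eta0 eta1]] _ PPis Vval PN PiN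
  alpha0 Uge.
have sysR k : (k < N)%N -> (cR sys k)^T = cR sys k /\ (cRb sys k)^T = cRb sys k.
  by case/sysS.
have Psym k : (k <= N)%N -> (P k)^T = P k /\ (Pi k)^T = Pi k.
  rewrite leq_eqVlt => /predU1P[->|/PPis //].
  by rewrite PN PiN linearD /= Gs Gbs.
have Uunit := weights_unit alpha0 Uge.
have adm l i v c := @init_adm_affine R d T mu n N om eta ieta eta_indep l i v c.
have ric k : (k < N)%N -> P k = riccatiP sys P k /\ Pi k = riccatiPi sys P Pi k.
  have [j Nk] := ubnP (N - k); elim: j k Nk => // j IH k Nk kN.
  have [sQ sQb sR sRb] := sysS _ kN; have [sP sPi] := Psym _ kN.
  have [uU uUb] := Uunit _ kN; have [sPk sPik] := PPis _ kN.
  apply: (mean_field_qf_inj ieta eta0 eta1 (i := Ordinal n0)) => //;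
    [exact: riccatiP_sym|exact: riccatiPi_sym|] => v c.
  have [ixi _] := adm k (Ordinal n0) v c.
  apply: EFin_inj; rewrite -[LHS]Vval //.
  apply: (V_riccati mom sysR Psym PN PiN alpha0 Uge) => //; first exact: noise.
  move=> i /andP[ki iN]; apply: IH => //.
  by apply: leq_trans (ltn_sub2l kN ki) _; rewrite -ltnS.
split; first by split.
have adm0 : init_adm mu N om 0 (fun=> 0 : 'cV[R]_n).
  have := adm 0%N (Ordinal n0) 0 0.
  by under eq_fun do rewrite scaler0 addr0.
have [ixi _] := adm0; have noise0 := noise _ _ N0 adm0.
have E0 : Ex mu (fun w => sqnorm ((fun=> 0 : 'cV[R]_n) w)) = 0.
  by rewrite sqnormE qfE bl0l Ex_cst.
have [c c0 hc] := energy_control_le sys mom P Pi ixi noise0 E0.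
exists (alpha / (c + 1)); split; first by rewrite divr_gt0 // ltr_wpDl.
move=> u uad.
rewrite (J_decomposition mom ixi noise0 uad sysR Psym PN PiN Uunit N0); last first.
  by move=> k /andP[_ /ric].
rewrite /mean_field_qf Evec_cst qfE bl0l.
rewrite (_ : (fun w => qf _ _) = fun=> 0); last first.
  by apply/funext => w; rewrite /centered Evec_cst subrr qfE bl0l.
rewrite Ex_cst !add0r.
set tot := \sum_(i < N) deviation mu sys P Pi i (state mu sys om 0 (fun=> 0) u i) (u i).
have tot0 : 0 <= tot by apply: sumr_ge0 => i _; exact: deviation_ge0.
apply: (@le_trans _ _ (alpha * tot)).
  rewrite -mulrA ler_wpM2l ?(ltW alpha0) // mulrC ler_pdivrMr ?ltr_wpDl //.
  apply: (@le_trans _ _ (c * tot)); first exact: hc.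
  by rewrite mulrDr mulr1 mulrC lerDl.
rewrite big_mkord /tot mulr_sumr; apply: ler_sum => i _.
by have [Ua Uba] := Uge _ (ltn_ord i); apply: (residual_ge ixi noise0 uad Ua Uba); rewrite ltn_ord.
Qed.
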